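(* Let $X$ be a real Banach space and let $f:\mathbb{R}\times X\to\mathbb{R}$ be a $C^1$ function such that $f(\lambda,0)=0$ and $f'_\lambda(0)=0$ for all $\lambda\in\mathbb{R}$. Assume that: (i) $f$ satisfies the $(PS)_{\mathbb{R},\mathbb{R}}$ condition. (ii) For every $N\in\mathbb{N}$, $\partial_1 f$ is bounded on the set $\{(\lambda,x)\in[-N,N]\times X: f(\lambda,x)\in[-N,N]\}$. (iii) The trivial critical pairs $(-1,0)$ and $(1,0)$ are not bifurcation points of $f$. (iv) There exists $\varepsilon_*>0$ such that for every $0<\varepsilon<\varepsilon_*$ the pairs of spaces $\left(f_{-1}^{(\varepsilon)},f_{-1}^{(-\varepsilon)}\right)$ and $\left(f_{1}^{(\varepsilon)},f_{1}^{(-\varepsilon)}\right)$ are not homotopically equivalent. Then $E_f$ contains a connected subset intersecting $Z_{\mathrm{in}}=[-1,1]\times\{0\}$ which either (1) is unbounded in $\mathbb{R}^2$, or else (2) intersects $\{-1,1\}\times\mathbb{R}$.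
   Context: For $\lambda\in\mathbb{R}$, $f_\lambda:X\to\mathbb{R}$ denotes the map $x\mapsto f(\lambda,x)$, and $f'_\lambda(x)\in X^*$ its Fréchet derivative at $x$. $\partial_1 f(\lambda,x)=\frac{\partial f}{\partial\lambda}(\lambda,x)$. Sublevel sets: for continuous $\varphi:X\to\mathbb{R}$ and $a\in\mathbb{R}$, $\varphi^{(a)}=\{x\in X:\varphi(x)\le a\}$. Critical pairs: $S_f=\{(\lambda,y)\in\mathbb{R}^2: f_\lambda(x)=y,\ f'_\lambda(x)=0\text{ for some }x\in X\}$ is the set of critical pairs; $Z=\mathbb{R}\times\{0\}\subseteq S_f$ is the set of trivial critical pairs. A trivial critical pair $(\lambda_0,0)$ is a bifurcation point of $f$ if every neighbourhood of it in $\mathbb{R}^2$ contains non-trivial critical pairs (elements of $S_f\setminus Z$). $E_f=\overline{S_f\setminus Z}$ (closure in $\mathbb{R}^2$). Palais-Smale conditions: for a compact interval $I\subset\mathbb{R}$ and $c\in\mathbb{R}$, $f$ satisfies $(PS)_{I,c}$ if every sequence $(\lambda_n,x_n)\in I\times X$ with $f_{\lambda_n}(x_n)\to c$ and $f'_{\lambda_n}(x_n)\to 0$ in $X^*$ has a subsequence along which $x_{n_k}$ converges to a point of $X$. For $J\subset\mathbb{R}$, $f$ satisfies $(PS)_{I,J}$ if it satisfies $(PS)_{I,c}$ for every $c\in J$. $f$ satisfies $(PS)_{\mathbb{R},\mathbb{R}}$ if it satisfies $(PS)_{[-N,N],\mathbb{R}}$ for every $N\in\mathbb{N}$. Pairs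 of spaces: a pair $(X,A)$ is a topological space $X$ with a subset $A\subseteq X$. A map of pairs $F:(X,A)\to(Y,B)$ is a continuous $F:X\to Y$ with $F(A)\subseteq B$. Two maps of pairs $F,G:(X,A)\to(Y,B)$ are homotopic if there is a continuous $h:[0,1]\times X\to Y$ with $h(0,\cdot)=F$, $h(1,\cdot)=G$ and $h(t,x)\in B$ for all $x\in A$, $t\in[0,1]$. Two pairs are homotopically equivalent if there are maps of pairs $F:(X,A)\to(Y,B)$ and $G:(Y,B)\to(X,A)$ such that $G\circ F$ and $F\circ G$ are homotopic, as maps of pairs, to the respective identities. *)

(* Defs.v *)
From HB Require Import structures.
From mathcomp Require Import all_boot all_order all_algebra.
From mathcomp Require Import all_classical all_reals all_analysis.

Set Implicit Arguments.
Unset Strict Implicit.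
Unset Printing Implicit Defensive.
Import Order.TTheory GRing.Theory Num.Theory.
Import numFieldNormedType.Exports.
Local Open Scope classical_set_scope.
Local Open Scope ring_scope.

Section PairsOfSpaces.
Variable R : realType.

Definition pair_map (T U : topologicalType) (A : set T) (B : set U)
    (F : T -> U) : Prop :=
  continuous F /\ F @` A `<=` B.

(* The time parameter is a real number; only its values in [0, 1] matter. *)
Definition pair_homotopic (T U : topologicalType) (A : set T) (B : set U)
    (F G : T -> U) : Prop :=
  exists h : R * T -> U,
    [/\ {within `[0, 1] `*` [set: T], continuous h},
        forall x, h (0, x) = F x,
        forall x, h (1, x) = G x &
        forall t x, t \in `[0, 1] -> A x -> B (h (t, x))].

Definition pair_homotopy_equivalent (T U : topologicalType)
    (A : set T) (B : set U) : Prop :=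
  exists (F : T -> U) (G : U -> T),
    [/\ pair_map A B F, pair_map B A G,
        pair_homotopic A A (G \o F) idfun &
        pair_homotopic B B (F \o G) idfun].

End PairsOfSpaces.

Section Functional.
Variables (R : realType) (X : completeNormedModType R).
Implicit Types (f : R * X -> R) (l c : R) (x : X).

(* The norm of the dual space; it is +oo on unbounded functionals, and
   differentials of differentiable functions are bounded. *)
Definition dual_norm (V : normedModType R) (u : V -> R) : \bar R :=
  ereal_sup [set `|u v|%:E | v in [set v | `|v| <= 1]].

Definition C1 (V : normedModType R) (g : V -> R) : Prop :=
  (forall p, differentiable g p) /\
  (forall p, dual_norm ('d g q \- 'd g p) @[q --> p] --> 0%E).

Definition slice f l : X -> R := fun x => f (l, x).

Definition critical f l x : Prop := 'd (slice f l) x = cst 0 :> (X -> R).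

Definition partial1 f (p : R * X) : R := derive1 (fun l => f (l, p.2)) p.1.

Definition sublevel (phi : X -> R) (a : R) : set X := [set x | phi x <= a].

Definition critical_pairs f : set (R * R) :=
  [set p | exists x, f (p.1, x) = p.2 /\ critical f p.1 x].

Definition trivial_pairs : set (R * R) := [set p | p.2 = 0].

Definition bifurcation_point f (p : R * R) : Prop :=
  trivial_pairs p /\
  forall U, nbhs p U -> (U `&` (critical_pairs f `\` trivial_pairs)) !=set0.

Definition E_set f : set (R * R) :=
  closure (critical_pairs f `\` trivial_pairs).

Definition PS_at f (I : set R) (c : R) : Prop :=
  forall (l : nat -> R) (x : nat -> X),
    (forall n, I (l n)) ->
    f (l n, x n) @[n --> \oo] --> c ->
    dual_norm ('d (slice f (l n)) (x n)) @[n --> \oo] --> 0%E ->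
    exists2 k : nat -> nat, increasing_seq k & cvgn (x \o k).

Definition PS_on f (I J : set R) : Prop := forall c, J c -> PS_at f I c.

Definition PS f : Prop :=
  forall N : nat, PS_on f `[- N%:R, N%:R] [set: R].

(* Homotopy equivalence of (f_l^(e), f_l^(-e)) and (f_m^(e), f_m^(-e)) with the
   subspace topologies; [0 <= e] is meant, so that the second set of a pair
   is contained in the first one. *)
Definition sublevel_pairs_equivalent f (l m e : R) : Prop :=
  @pair_homotopy_equivalent R
    (set_type (sublevel (slice f l) e)) (set_type (sublevel (slice f m) e))
    [set x | sublevel (slice f l) (- e) (val x)]
    [set x | sublevel (slice f m) (- e) (val x)].

End Functional.

(* Main.v *)
Require Import Defs.
From HB Require Import structures.
From mathcomp Require Import all_boot all_order all_algebra.
From mathcomp Require Import all_classical all_reals all_analysis.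
From mathcomp Require Import wochoice lra.
Import Order.TTheory GRing.Theory Num.Theory.
Import numFieldNormedType.Exports.
Local Open Scope classical_set_scope.
Local Open Scope ring_scope.
Set Implicit Arguments.
Unset Strict Implicit.
Unset Printing Implicit Defensive.

(* Every sublevel set is a subset of [X], and the bound on the derivative in the
   parameter gives inclusions [f_l <= y] in [f_m <= y + L |l - m|].  On a single
   slice, the Palais-Smale condition allows to push a sublevel set down through
   an interval of regular values.  Combining both, a pair of sublevel sets at
   regular levels keeps its homotopy type when the slice changes slightly.

   Suppose that the conclusion fails.  Then the part of [E_f] meeting the axis is
   enclosed in a compact set [D], open in [E_f] and contained in the open strip.
   Neither [K = Z_in u D] nor the closed set [F = E_f \ D] separates
   [(-1, e)] from [(1, e)] in the upper half-strip, and [K], [F] are disjoint, so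
   that the two points are joined by a path of regular values; likewise for
   [(-1, -e)] and [(1, -e)] in the lower half-strip.  Such a path need not be a
   graph over the parameter, but whenever it comes back to a slice, the two
   sublevel sets it selects there are homotopy equivalent by inclusion: an
   excursion consists of a horizontal step, a shorter path with the same
   property, and the reverse horizontal step.  Hence each path may be replaced
   with a graph with jumps, and following the two graphs from left to right
   transports the pair at [-1] to the pair at [1], against the last hypothesis. *)

(** * Truncated times and continuity of composites *)

Section Clamp.
Variable R : realType.
(** Clamped times let two homotopies be glued by one formula, each of them waiting while the other
    runs. *)
Definition clamp01 (t : R) : R := Num.max 0 (Num.min t 1).

Lemma clamp01_ge0 t : 0 <= clamp01 t.
Proof. by rewrite /clamp01 le_max lexx. Qed.

Lemma clamp01_le1 t : clamp01 t <= 1.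
Proof. by rewrite /clamp01 ge_max ler01 ge_min lexx orbT. Qed.

Lemma clamp01_le0 t : t <= 0 -> clamp01 t = 0.
Proof. by move=> t0; rewrite /clamp01 min_l ?max_l // (le_trans t0). Qed.

Lemma clamp01_ge1 t : 1 <= t -> clamp01 t = 1.
Proof. by move=> t1; rewrite /clamp01 min_r ?max_r. Qed.

Lemma continuous_clamp01 : continuous clamp01.
Proof.
move=> t; apply: (@continuous_max _ R (cst 0) (fun s => Num.min s 1)).
  exact: cvg_cst.
by apply: (@continuous_min _ R id (cst 1)); [exact: cvg_id|exact: cvg_cst].
Qed.

End Clamp.

Lemma continuous_comp2 (S T U V : topologicalType) (h : T * U -> V)
    (a : S -> T) (b : S -> U) :
  continuous h -> continuous a -> continuous b ->
  continuous (fun z => h (a z, b z)).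
Proof.
move=> ch ca cb z; apply: (@continuous_comp _ _ _ (fun z => (a z, b z)) h).
  by apply: cvg_pair; [exact: ca|exact: cb].
exact: ch.
Qed.

Lemma continuous_comp1 (S T U : topologicalType) (h : T -> U) (a : S -> T) :
  continuous h -> continuous a -> continuous (fun z => h (a z)).
Proof. by move=> ch ca z; apply: continuous_comp; [exact: ca|exact: ch]. Qed.

Lemma continuous_fst (S T : topologicalType) : continuous (@fst S T).
Proof. by move=> z; exact: cvg_fst. Qed.

Lemma continuous_snd (S T : topologicalType) : continuous (@snd S T).
Proof. by move=> z; exact: cvg_snd. Qed.

Lemma continuous_clampM (R : realType) (S : topologicalType) (f : S -> R) (c d : R) :
  continuous f -> continuous (fun z => clamp01 (c * f z - d)).
Proof.
move=> cf; apply: continuous_comp1; first exact: continuous_clamp01.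
move=> z; apply: cvgB; last exact: cvg_cst.
by apply: cvgM; [exact: cvg_cst|exact: cf].
Qed.

(** * Homotopy of pairs *)

(* Maps of pairs and their homotopies are taken to be defined on the whole
   ambient space; the time parameter then ranges over all of [R]. *)
Section Pairs.
Variables (R : realType) (X : normedModType R).
Implicit Types (P Q : set X * set X) (phi psi : X -> X).

Definition maps_pair P Q phi :=
  (forall x, P.1 x -> Q.1 (phi x)) /\ (forall x, P.2 x -> Q.2 (phi x)).

Definition htpy P Q phi psi := exists h : R * X -> X,
  [/\ continuous h, forall x, h (0, x) = phi x, forall x, h (1, x) = psi x &
      forall t, maps_pair P Q (fun x => h (t, x))].

Definition pair_equiv P Q := exists phi psi,
  [/\ continuous phi /\ continuous psi, maps_pair P Q phi, maps_pair Q P psi,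
      htpy P P id (psi \o phi) & htpy Q Q id (phi \o psi)].

Lemma maps_pair_comp P Q S phi psi :
  maps_pair P Q phi -> maps_pair Q S psi -> maps_pair P S (psi \o phi).
Proof.
by move=> [a b] [c d]; split=> x Px; [exact/c/a|exact/d/b].
Qed.

Lemma htpy_refl P Q phi : continuous phi -> maps_pair P Q phi ->
  htpy P Q phi phi.
Proof.
move=> cphi mphi; exists (fun z => phi z.2); split=> //.
by apply: continuous_comp1 => //; exact: continuous_snd.
Qed.

Lemma htpy_sym P Q phi psi : htpy P Q phi psi -> htpy P Q psi phi.
Proof.
move=> [h [ch h0 h1 hP]]; exists (fun z => h (1 - z.1, z.2)); split=> //.
- apply: (continuous_comp2 ch); last exact: continuous_snd.
  by move=> z; apply: cvgB; [exact: cvg_cst|exact: continuous_fst].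
- by move=> x /=; rewrite subr0.
- by move=> x /=; rewrite subrr.
- by move=> t; exact: (hP (1 - t)).
Qed.

(* In a normed space, homotopies are concatenated by an explicit formula. *)
Lemma htpy_trans P Q f1 f2 f3 : continuous f2 ->
  htpy P Q f1 f2 -> htpy P Q f2 f3 -> htpy P Q f1 f3.
Proof.
move=> cf2 [h [ch h0 h1 hP]] [k [ck k0 k1 kP]].
pose K (z : R * X) :=
  h (clamp01 (2 * z.1 - 0), z.2) + k (clamp01 (2 * z.1 - 1), z.2) - f2 z.2.
(* At every time one of the two terms equals [f2] and cancels, so that [K] only takes values of [h]
   or of [k] and respects the pairs. *)
have KE t x : K (t, x) = h (clamp01 (2 * t - 0), x) \/
              K (t, x) = k (clamp01 (2 * t - 1), x).
  rewrite /K /=; have [t2|t2] := leP t (1/2).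
    left; rewrite (@clamp01_le0 _ (2 * t - 1)) ?k0 ?addrK//; lra.
  right; rewrite (@clamp01_ge1 _ (2 * t - 0)) ?h1 1?addrAC ?subrr ?add0r//; lra.
exists K; split.
- have cl (d : R) : continuous (fun z : R * X => clamp01 (2 * z.1 - d)).
    by apply: continuous_clampM; exact: continuous_fst.
  have c2 := @continuous_snd R X.
  move=> z; apply: cvgB; last exact: (continuous_comp1 cf2 c2).
  apply: cvgD; first exact: (continuous_comp2 ch (cl 0) c2).
  exact: (continuous_comp2 ck (cl 1) c2).
- move=> x; rewrite /K /= !clamp01_le0; [|lra|lra].
  by rewrite h0 k0 addrK.
- move=> x; rewrite /K /= !clamp01_ge1; [|lra|lra].
  by rewrite h1 k1 addrAC subrr add0r.
- move=> t; split=> x Px; case: (KE t x) => ->.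
  + exact: (hP _).1.
  + exact: (kP _).1.
  + exact: (hP _).2.
  + exact: (kP _).2.
Qed.

Lemma htpy_comp P Q S T f g phi psi :
  continuous f -> continuous g -> maps_pair P Q f -> maps_pair S T g ->
  htpy Q S phi psi -> htpy P T (g \o phi \o f) (g \o psi \o f).
Proof.
move=> cf cg mf mg [h [ch h0 h1 hP]].
exists (fun z => g (h (z.1, f z.2))); split.
- apply: (continuous_comp1 cg); apply: (continuous_comp2 ch).
    exact: continuous_fst.
  by apply: (continuous_comp1 cf); exact: continuous_snd.
- by move=> x /=; rewrite h0.
- by move=> x /=; rewrite h1.
- move=> t; have := maps_pair_comp (maps_pair_comp mf (hP t)) mg.
  exact.
Qed.

Lemma pair_equiv_sym P Q : pair_equiv P Q -> pair_equiv Q P.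
Proof. by move=> [f [g [[? ?] ? ? ? ?]]]; exists g, f; split. Qed.

Lemma pair_equiv_trans P Q S :
  pair_equiv P Q -> pair_equiv Q S -> pair_equiv P S.
Proof.
move=> [f [g [[cf cg] mf mg hgf hfg]]] [f' [g' [[cf' cg'] mf' mg' hgf' hfg']]].
have cc (a b : X -> X) : continuous a -> continuous b -> continuous (a \o b).
  by move=> ca cb; apply: continuous_comp1.
exists (f' \o f), (g \o g'); split.
- by split; exact: cc.
- exact: maps_pair_comp mf mf'.
- exact: maps_pair_comp mg' mg.
- apply: (htpy_trans _ hgf); first exact: cc.
  exact: (htpy_comp cf cg mf mg hgf').
- apply: (htpy_trans _ hfg'); first exact: cc.
  exact: (htpy_comp cg' cf' mg' mf' hfg).
Qed.

(** A substitute for the vanishing of relative homology, invariant under [pair_equiv]. *)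
Definition null_pair P := exists2 psi, htpy P P id psi &
  forall x, P.1 x -> P.2 (psi x).

Lemma null_pair_equiv P Q : pair_equiv P Q -> null_pair P -> null_pair Q.
Proof.
move=> [f [g [[cf cg] mf mg hgf hfg]]] [psi hpsi psiP].
exists (f \o psi \o g); last by move=> x /mg.1 /psiP /mf.2.
apply: (htpy_trans _ hfg); first by apply: continuous_comp1.
exact: (htpy_comp cg cf mg mf hpsi).
Qed.

End Pairs.

(** * From ambient maps to maps of subspaces *)

Section Restriction.
Variables (R : realType) (X : normedModType R).
Implicit Types (A B : set X) (P Q : set X * set X).

Lemma set_type_continuous (B : set X) (T : topologicalType)
    (F : T -> set_type B) :
  continuous (fun x => set_val (F x)) -> continuous F.
Proof. by move=> cF; apply/continuous_comp_initial. Qed.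

Lemma set_val_continuous A : continuous (set_val : set_type A -> X).
Proof. exact: (@initial_continuous _ X set_val). Qed.

Definition restrict A B (phi : X -> X) (AB : forall x, A x -> B (phi x))
    (x : set_type A) : set_type B :=
  exist _ (phi (set_val x)) (mem_set (AB _ (set_valP x))).

Lemma restrict_continuous A B phi (AB : forall x, A x -> B (phi x)) :
  continuous phi -> continuous (restrict AB).
Proof.
move=> cphi; apply: set_type_continuous => /=.
exact: (continuous_comp1 cphi (@set_val_continuous A)).
Qed.

Lemma restrict_htpy P Q phi psi (F G : set_type P.1 -> set_type Q.1) :
  (forall x, set_val (F x) = phi (set_val x)) ->
  (forall x, set_val (G x) = psi (set_val x)) ->
  htpy P Q phi psi ->
  @pair_homotopic R (set_type P.1) (set_type Q.1)
    [set x | P.2 (val x)] [set x | Q.2 (val x)] F G.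
Proof.
move=> Fphi Gpsi [h [ch h0 h1 hP]].
exists (fun z => restrict (hP z.1).1 z.2); split.
- apply: continuous_subspaceT; apply: set_type_continuous => /=.
  apply: (continuous_comp2 ch); first exact: continuous_fst.
  exact: (continuous_comp1 (@set_val_continuous P.1) (@continuous_snd _ _)).
- by move=> x; apply/val_inj; rewrite /= h0 -Fphi.
- by move=> x; apply/val_inj; rewrite /= h1 -Gpsi.
- by move=> t x _; exact: (hP t).2.
Qed.

Lemma pair_equiv_homotopy_equivalent P Q : pair_equiv P Q ->
  @pair_homotopy_equivalent R (set_type P.1) (set_type Q.1)
    [set x | P.2 (val x)] [set x | Q.2 (val x)].
Proof.
move=> [f [g [[cf cg] mf mg hgf hfg]]].
exists (restrict mf.1), (restrict mg.1); split.
- split; first exact: restrict_continuous.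
  by move=> _ [x Px <-]; exact: mf.2.
- split; first exact: restrict_continuous.
  by move=> _ [x Px <-]; exact: mg.2.
- by apply: (restrict_htpy _ _ (htpy_sym hgf)).
- by apply: (restrict_htpy _ _ (htpy_sym hfg)).
Qed.

End Restriction.
(** * Deformations between levels *)

Section Levels.
Variables (R : realType) (X : completeNormedModType R).
Implicit Types (g : X -> R) (a b c l u r : R).

Definition level_pair g u l : set X * set X := (sublevel g u, sublevel g l).

Definition pushes g y r (h : R * X -> X) :=
  [/\ continuous h, forall x, h (0, x) = x,
      forall t x, g (h (t, x)) <= g x &
      forall x, g x <= y + r -> g (h (1, x)) <= y - r].

Definition pushable g y r := exists h, pushes g y r h.

(* Preserving also the sublevel sets outside of [`[a, b]] lets the deformation
   act on pairs having [a] and [b] as one of their two levels. *)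
Definition null_between g a b := exists h : R * X -> X,
  [/\ continuous h, forall x, h (0, x) = x,
      forall c t x, c <= a \/ b <= c -> g x <= c -> g (h (t, x)) <= c &
      forall x, g x <= b -> g (h (1, x)) <= a].

(** The inclusion between the two sublevel sets is a homotopy equivalence, witnessed by a
    deformation. Both orders are allowed, as levels may rise or fall along a path. *)
Definition equilevel g a b :=
  (a <= b /\ null_between g a b) \/ (b <= a /\ null_between g b a).

(** The end of the deformation and the inclusion of [Q] in [P] are homotopy inverse to each other,
    [h] itself being both homotopies. *)
Lemma deform_pair_equiv (P Q : set X * set X) (h : R * X -> X) :
  continuous h -> (forall x, h (0, x) = x) ->
  (forall t, maps_pair P P (fun x => h (t, x))) ->
  (forall t, maps_pair Q Q (fun x => h (t, x))) ->
  maps_pair P Q (fun x => h (1, x)) -> maps_pair Q P id ->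
  pair_equiv P Q.
Proof.
move=> ch h0 hP hQ h1 QP; exists (fun x => h (1, x)), id; split=> //.
- split; last by move=> x; exact: cvg_id.
  apply: (continuous_comp2 ch); first by move=> x; exact: cvg_cst.
  by move=> x; exact: cvg_id.
- by exists h; split.
- by exists h; split.
Qed.

(** The two deformations run simultaneously; since neither raises [g], each keeps its effect in the
    composite. *)
Lemma pushes2 g u l r : pushable g u r -> pushable g l r ->
  exists2 h, pushes g u r h & pushes g l r h.
Proof.
move=> [h [ch h0 hg h1]] [k [ck k0 kg k1]].
pose K (z : R * X) := k (z.1, h (z.1, z.2)).
have cK : continuous K.
  apply: (continuous_comp2 ck); first exact: continuous_fst.
  by apply: (continuous_comp2 ch); [exact: continuous_fst|exact: continuous_snd].
have K0 x : K (0, x) = x by rewrite /K /= k0 h0.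
have Kg t x : g (K (t, x)) <= g x by rewrite /K (le_trans (kg _ _)).
exists K; split=> // x gx.
- by rewrite /K /= (le_trans (kg _ _)) // h1.
- by rewrite /K /= k1 // (le_trans (hg _ _)).
Qed.

Lemma null_between_null_pair g a b : a <= b -> null_between g a b ->
  null_pair (level_pair g b a).
Proof.
move=> ab [h [ch h0 hg h1]]; exists (fun x => h (1, x)); last exact: h1.
exists h; split=> // t; split=> x /= gx; apply: hg => //.
- by right.
- by left.
Qed.

(** The homotopy [h] respects the levels [a] and [b] only. To respect the outer levels too, [s]
    first pushes down at both levels, then [h] runs up to the time [chi (g x)], which is 0 below [a]
    and above [b + r], and 1 on [[a + r, b]]. Points between [b] and [b + r] are already below [b]
    when [h] starts, and those between [a] and [a + r] already below [a]. *)
Lemma null_pair_null_between g a b r : continuous g -> 0 < r -> a <= b ->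
  pushable g a r -> pushable g b r -> null_pair (level_pair g b a) ->
  null_between g a b.
Proof.
move=> cg r0 ab pa pb [psi [h [ch h0 h1 hP]] psiP].
have [s [cs s0 sg sb] [_ _ _ sa]] := pushes2 pb pa.
pose chi (y : R) := clamp01 ((y - a) / r) * clamp01 ((b + r - y) / r).
have chi0 y : y <= a \/ b + r <= y -> chi y = 0.
  rewrite /chi => -[ya|yb].
    by rewrite clamp01_le0 ?mul0r// pmulr_lle0 ?invr_gt0// subr_le0.
  by rewrite [X in _ * X]clamp01_le0 ?mulr0// pmulr_lle0 ?invr_gt0// subr_le0.
have chi1 y : a + r <= y <= b -> chi y = 1.
  move=> /andP[ya yb].
  by rewrite /chi !clamp01_ge1 ?mulr1// ler_pdivlMr// mul1r; lra.
have cchi : continuous (fun x => chi (g x)).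
  have c1 : continuous (fun x => (g x - a) / r).
    move=> x; apply: cvgM; last exact: cvg_cst.
    by apply: cvgB; [exact: cg|exact: cvg_cst].
  have c2 : continuous (fun x => (b + r - g x) / r).
    move=> x; apply: cvgM; last exact: cvg_cst.
    by apply: cvgB; [exact: cvg_cst|exact: cg].
  move=> x; apply: cvgM.
    exact: (continuous_comp1 (@continuous_clamp01 R) c1).
  exact: (continuous_comp1 (@continuous_clamp01 R) c2).
have c1 := @continuous_fst R X; have c2 := @continuous_snd R X.
pose H (z : R * X) := h (clamp01 (2 * z.1 - 1) * chi (g z.2),
                         s (clamp01 (2 * z.1 - 0), z.2)).
have H_early t x : t <= 1/2 -> H (t, x) = s (clamp01 (2 * t - 0), x).
  move=> t2; rewrite /H /= [X in X * _]clamp01_le0; last lra.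
  by rewrite mul0r h0.
have H_late t x : 1/2 <= t ->
    H (t, x) = h (clamp01 (2 * t - 1) * chi (g x), s (1, x)).
  move=> t2; rewrite /H /=; congr h; congr pair; congr s; congr pair.
  by rewrite clamp01_ge1//; lra.
have cl (d : R) : continuous (fun z : R * X => clamp01 (2 * z.1 - d)).
  exact: continuous_clampM.
exists H; split.
- apply: (continuous_comp2 ch); last exact: (continuous_comp2 cs (cl 0) c2).
  by move=> z; apply: cvgM; [exact: cl|exact: (continuous_comp1 cchi c2)].
- by move=> x; rewrite H_early ?clamp01_le0 ?s0//; lra.
- move=> c t x cab gx; have [t2|/ltW t2] := leP t (1/2).
    by rewrite H_early// (le_trans (sg _ _)).
  rewrite H_late//; have sx := sg 1 x.
  case: cab => [ca|bc].
    by rewrite chi0 ?mulr0 ?h0; [exact: le_trans sx gx|left; exact: le_trans gx ca].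
  have [gb|/ltW gb] := leP (g x) (b + r); last first.
    by rewrite chi0 ?mulr0 ?h0; [exact: le_trans sx gx|right].
  apply: le_trans bc; apply: (hP _).1 => /=.
  by rewrite /sublevel /= (le_trans (sb _ gb)); lra.
- move=> x gx; rewrite H_late; last lra.
  have [ga|/ltW ga] := leP (g x) (a + r).
    by apply: (hP _).2 => /=; rewrite /sublevel /= (le_trans (sa _ ga)); lra.
  rewrite chi1 ?ga// mulr1 clamp01_ge1 ?h1; last lra.
  by apply: psiP; exact: le_trans (sg 1 x) gx.
Qed.

Lemma equilevel_sym g a b : equilevel g a b -> equilevel g b a.
Proof. by case=> ?; [right|left]. Qed.

Lemma equilevel_refl g a : equilevel g a a.
Proof.
left; split=> //; exists snd; split=> //; exact: continuous_snd.
Qed.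

Lemma pushable_equilevel g a b r : pushable g a r -> a <= b <= a + r -> 0 <= r ->
  equilevel g a b.
Proof.
move=> [h [ch h0 hg h1]] /andP[ab bar] r0; left; split=> //.
exists h; split=> //.
  by move=> c t x _; apply: le_trans.
by move=> x gx; rewrite (le_trans (h1 _ _))//; lra.
Qed.

(* Two out of three, as for the vanishing of relative homology. *)
Section TwoOfThree.
Variables (g : X -> R) (a b c r : R).
Hypotheses (cg : continuous g) (r0 : 0 < r) (ab : a <= b) (bc : b <= c).
Hypotheses (pa : pushable g a r) (pb : pushable g b r) (pc : pushable g c r).

Lemma null_between_cat :
  null_between g a b -> null_between g b c -> null_between g a c.
Proof.
move=> [h [ch h0 hg h1]] [k [ck k0 kg k1]].
exists (fun z => h (z.1, k z)); split.
- by apply: (continuous_comp2 ch) => //; exact: continuous_fst.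
- by move=> x; rewrite k0 h0.
- move=> d t x dac gx /=; apply: hg.
    by case: dac => ?; [left|right; exact: le_trans bc _].
  by apply: kg => //; case: dac => ?; [left; exact: le_trans ab|right].
- by move=> x gx; apply/h1/k1.
Qed.

(** The deformation [h] may leave the sublevel set of [b], but not that of [c]; the end map of [k]
    brings it back. *)
Lemma null_between_lower :
  null_between g a c -> null_between g b c -> null_between g a b.
Proof.
move=> [h [ch h0 hg h1]] [k [ck k0 kg k1]].
apply: (null_pair_null_between cg r0) => //.
pose f x := k (1, x); pose h' x := h (1, x).
have cf : continuous f.
  apply: (continuous_comp2 ck); first by move=> x; exact: cvg_cst.
  by move=> x; exact: cvg_id.
exists (f \o h').
  apply: (htpy_trans cf).
    exists k; split=> // t; split=> x gx; apply: kg => //; left => //.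
  exists (fun z => f (h z)); split=> //.
  - exact: continuous_comp1.
  - by move=> x; rewrite h0.
  - move=> t; split=> x gx.
      by apply: k1; apply: hg; [right|exact: le_trans bc].
    by apply: kg; [left|apply: hg => //; left].
move=> x gx; apply: kg; first by left.
by apply: h1; exact: le_trans bc.
Qed.

(** Here the end map of [k] comes first: it sends the sublevel set of [b] into that of [a], which
    [h] preserves. *)
Lemma null_between_upper :
  null_between g a c -> null_between g a b -> null_between g b c.
Proof.
move=> [h [ch h0 hg h1]] [k [ck k0 kg k1]].
apply: (null_pair_null_between cg r0) => //.
pose f x := k (1, x); pose h' x := h (1, x).
have cf : continuous f.
  apply: (continuous_comp2 ck); first by move=> x; exact: cvg_cst.
  by move=> x; exact: cvg_id.
exists (h' \o f).
  apply: (htpy_trans cf).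
    exists k; split=> // t; split=> x gx; apply: kg => //; right => //.
  exists (fun z => h (z.1, f z.2)); split=> //.
  - apply: (continuous_comp2 ch); first exact: continuous_fst.
    exact: (continuous_comp1 cf (@continuous_snd _ _)).
  - move=> t; split=> x gx.
      by apply: hg; [right|apply: kg => //; right].
    by apply: (le_trans _ ab); apply: hg; [left|exact: k1].
move=> x gx; apply: (le_trans _ ab).
by apply: h1; apply: kg => //; right.
Qed.

End TwoOfThree.

Lemma equilevel_trans g a b c r : continuous g -> 0 < r ->
  pushable g a r -> pushable g b r -> pushable g c r ->
  equilevel g a b -> equilevel g b c -> equilevel g a c.
Proof.
move=> cg r0 pa pb pc [] [ab nab] [] [bc nbc].
- left; split; first exact: le_trans bc.
  exact: (null_between_cat ab bc nab nbc).
- have [ac|/ltW ca] := leP a c.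
    by left; split=> //; exact: (null_between_lower cg r0 ac bc).
  by right; split=> //; exact: (null_between_lower cg r0 ca ab).
- have [ac|/ltW ca] := leP a c.
    by left; split=> //; exact: (null_between_upper cg r0 ab ac).
  by right; split=> //; exact: (null_between_upper cg r0 bc ca).
- right; split; first exact: le_trans ab.
  exact: (null_between_cat bc ab nbc nab).
Qed.

Lemma equilevel_pair_equiv_top g u u' l : l <= u -> l <= u' ->
  equilevel g u u' -> pair_equiv (level_pair g u l) (level_pair g u' l).
Proof.
move=> + + H; wlog : u u' H / u <= u' /\ null_between g u u'.
  move=> WH lu lu'; case: (H) => ?; first exact: WH.
  by apply: pair_equiv_sym; apply: WH => //; exact: equilevel_sym.
move=> [uu' [h [ch h0 hg h1]]] lu lu'; apply: pair_equiv_sym.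
apply: (deform_pair_equiv ch h0).
- by move=> t; split=> x; apply: hg; [right|left].
- by move=> t; split=> x; apply: hg; left.
- by split=> x; [exact: h1|apply: hg; left].
- by split=> x //= gx; exact: le_trans uu'.
Qed.

Lemma equilevel_pair_equiv_bottom g u l l' : l <= u -> l' <= u ->
  equilevel g l l' -> pair_equiv (level_pair g u l) (level_pair g u l').
Proof.
move=> + + H; wlog : l l' H / l <= l' /\ null_between g l l'.
  move=> WH lu lu'; case: (H) => ?; first exact: WH.
  by apply: pair_equiv_sym; apply: WH => //; exact: equilevel_sym.
move=> [ll' [h [ch h0 hg h1]]] lu lu'; apply: pair_equiv_sym.
apply: (deform_pair_equiv ch h0).
- by move=> t; split=> x; apply: hg; right.
- by move=> t; split=> x; apply: hg; [right|left].
- by split=> x; [apply: hg; right|exact: h1].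
- by split=> x //= gx; exact: le_trans ll'.
Qed.

Definition interleaved g1 g2 k c :=
  forall x, (g1 x <= c -> g2 x <= c + k) /\ (g2 x <= c -> g1 x <= c + k).

(** Passing from one function to the other raises levels by at most [k], and pushing down makes up
    for it. A composite is deformed to the identity through points raised by at most [2 * k], which
    the last push still catches. *)
Lemma interleaved_pair_equiv g1 g2 k r u l : 0 <= k -> 2 * k <= r ->
  pushable g1 u r -> pushable g1 l r -> pushable g2 u r -> pushable g2 l r ->
  interleaved g1 g2 k u -> interleaved g1 g2 k (u + k) ->
  interleaved g1 g2 k l -> interleaved g1 g2 k (l + k) ->
  pair_equiv (level_pair g1 u l) (level_pair g2 u l).
Proof.
move=> k0 kr pu1 pl1 pu2 pl2 iu iuk il ilk.
have [h1 hu1 hl1] := pushes2 pu1 pl1; have [h2 hu2 hl2] := pushes2 pu2 pl2.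
have key f1 f2 h h' : pushes f1 u r h -> pushes f1 l r h ->
    pushes f2 u r h' -> pushes f2 l r h' ->
    (forall x, f1 x <= u -> f2 x <= u + k) ->
    (forall x, f1 x <= l -> f2 x <= l + k) ->
    (forall x, f2 x <= u + k -> f1 x <= u + k + k) ->
    (forall x, f2 x <= l + k -> f1 x <= l + k + k) ->
    maps_pair (level_pair f1 u l) (level_pair f2 u l) (fun x => h' (1, x)) /\
    htpy (level_pair f1 u l) (level_pair f1 u l) id
      (fun x => h (1, h' (1, x))).
  move=> [ch h0 hg hu] [_ _ _ hl] [ch' h0' hg' hu'] [_ _ _ hl'] fu fl fu' fl'.
  split.
    split=> x fx; rewrite /= /sublevel /=.
      by rewrite (le_trans (hu' _ _))//; [have := fu _ fx; lra|lra].
    by rewrite (le_trans (hl' _ _))//; [have := fl _ fx; lra|lra].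
  have cc : continuous (fun x => h (1, x)).
    apply: (continuous_comp2 ch); first by move=> x; exact: cvg_cst.
    by move=> x; exact: cvg_id.
  apply: (htpy_trans cc).
    by exists h; split=> // t; split=> x fx; exact: le_trans (hg _ _) fx.
  exists (fun z => h (1, h' z)); split=> //.
  - exact: (continuous_comp1 cc ch').
  - by move=> x; rewrite h0'.
  - move=> t; split=> x fx; rewrite /= /sublevel /=.
      rewrite (le_trans (hu _ _))//; last lra.
      have /fu' : f2 (h' (t, x)) <= u + k by rewrite (le_trans (hg' _ _))// fu.
      lra.
    rewrite (le_trans (hl _ _))//; last lra.
    have /fl' : f2 (h' (t, x)) <= l + k by rewrite (le_trans (hg' _ _))// fl.
    lra.
have [m1 H1] := key g1 g2 h1 h2 hu1 hl1 hu2 hl2 (fun x => (iu x).1)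
  (fun x => (il x).1) (fun x => (iuk x).2) (fun x => (ilk x).2).
have [m2 H2] := key g2 g1 h2 h1 hu2 hl2 hu1 hl1 (fun x => (iu x).2)
  (fun x => (il x).2) (fun x => (iuk x).1) (fun x => (ilk x).1).
have c1 (h : R * X -> X) y : pushes g1 y r h \/ pushes g2 y r h ->
    continuous (fun x => h (1, x)).
  move=> hc; have ch : continuous h by case: hc => -[].
  apply: (continuous_comp2 ch); first by move=> x; exact: cvg_cst.
  by move=> x; exact: cvg_id.
exists (fun x => h2 (1, x)), (fun x => h1 (1, x)); split=> //.
by split; [apply: c1; right; exact: hu2|apply: c1; left; exact: hu1].
Qed.

(** The detour through [null_pair] is what makes the relation transportable, since that notion is
    invariant under equivalence of pairs. *)
Lemma interleaved_equilevel g1 g2 k r a b : continuous g2 -> 0 < r ->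
  0 <= k -> 2 * k <= r ->
  pushable g1 a r -> pushable g1 b r -> pushable g2 a r -> pushable g2 b r ->
  interleaved g1 g2 k a -> interleaved g1 g2 k (a + k) ->
  interleaved g1 g2 k b -> interleaved g1 g2 k (b + k) ->
  equilevel g1 a b -> equilevel g2 a b.
Proof.
move=> cg2 r0 k0 kr pa1 pb1 pa2 pb2 ia iak ib ibk [[ab n]|[ba n]].
  left; split=> //; apply: (null_pair_null_between cg2 r0 ab pa2 pb2).
  apply: null_pair_equiv (null_between_null_pair ab n).
  exact: (interleaved_pair_equiv k0 kr).
right; split=> //; apply: (null_pair_null_between cg2 r0 ba pb2 pa2).
apply: null_pair_equiv (null_between_null_pair ba n).
exact: (interleaved_pair_equiv k0 kr).
Qed.

End Levels.
(** * Deformation below a regular value *)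

(* A family of 1-Lipschitz functions is made locally finite (above
   any positive threshold) without losing a point of its support: index it by
   a well-ordered set and subtract from each function the supremum of the
   previous ones. *)
Section LocallyFinite.
Variables (R : realType) (X : normedModType R).
Variables (f : X -> X -> R).
Hypothesis f_ge0 : forall y x, 0 <= f y x.
Hypothesis f_le1 : forall y x, f y x <= 1.
Hypothesis f_lip : forall y x z, f y x <= f y z + `|x - z|.

Let wo := sval (well_ordering_principle X).
Let wo_wo : well_order wo := svalP (well_ordering_principle X).
Let prec (y z : X) := wo y z /\ y <> z.

Let prec_total y z : y <> z -> prec y z \/ prec z y.
Proof.
move=> yz; have /(_ y z isT isT)/orP := wo_chainW (withinW wo_wo (A := predT)).
by case=> yz'; [left; split|right; split=> // /esym].
Qed.

Let prec_min (S : set X) : S !=set0 ->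
  exists2 y, S y & forall z, prec z y -> ~ S z.
Proof.
move=> [s Ss]; have [|y []] := wo_wo (A := [pred x | `[< S x >]]).
  by exists s; apply/asboolP.
move=> [/asboolP Sy ymin] _; exists y => // z [zy zny] Sz; apply: zny.
have yz : wo y z by apply: ymin; apply/asboolP.
by apply: (wo_chain_antisymmetric (withinW wo_wo (A := predT))); rewrite ?zy.
Qed.

Let previous y x : set R := [set t | t = 0 \/ exists2 z, prec z y & t = f z x].

Let previous_sup y x : has_sup (previous y x).
Proof.
split; first by exists 0; left.
by exists 1 => _ [->//|[z _ ->]].
Qed.

Definition reduced y x := f y x - sup (previous y x).

Let sup_prev_ge0 y x : 0 <= sup (previous y x).
Proof. by apply: ub_le_sup; [exact: (previous_sup y x).2|left]. Qed.

Let sup_prev_ge y z x : prec z y -> f z x <= sup (previous y x).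
Proof.
by move=> zy; apply: ub_le_sup; [exact: (previous_sup y x).2|right; exists z].
Qed.

Let sup_prev_lip y x z : sup (previous y x) <= sup (previous y z) + `|x - z|.
Proof.
apply: ge_sup; first exact: (previous_sup y x).1.
move=> _ [->|[t ty ->]]; first by rewrite addr_ge0.
by rewrite (le_trans (f_lip t x z))// lerD2r sup_prev_ge.
Qed.

Lemma reduced_le y x : reduced y x <= f y x.
Proof. by rewrite /reduced lerBlDr lerDl sup_prev_ge0. Qed.

Lemma reduced_lip y x z : reduced y x <= reduced y z + 2 * `|x - z|.
Proof.
have := sup_prev_lip y z x; have := f_lip y x z; rewrite /reduced (distrC z x).
lra.
Qed.

(** At the first index whose function is positive at [x], nothing is subtracted. *)
Lemma reduced_pos x : (exists y, 0 < f y x) -> exists y, 0 < reduced y x.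
Proof.
move=> /(@prec_min (fun y => 0 < f y x)) [y fy miny]; exists y.
suff : sup (previous y x) <= 0 by rewrite /reduced; lra.
apply: ge_sup; first exact: (previous_sup y x).1.
by move=> _ [->//|[z zy ->]]; rewrite leNgt; apply/negP; exact: miny.
Qed.

(** The values at [x] of two such functions differ by at least [e], and all of them lie in
    [[0, 1]]. *)
Lemma reduced_finite x e : 0 < e -> finite_set [set y | e < reduced y x].
Proof.
move=> e0; set S := [set y | _].
have sep y z : S y -> S z -> prec y z -> f y x + e <= f z x.
  by move=> _ Sz /sup_prev_ge -/(_ x); move: Sz; rewrite /S /= /reduced; lra.
pose N (y : X) := Num.truncn (f y x / e).
have NP (y : X) : (N y)%:R <= f y x / e < (N y).+1%:R.
  by apply: truncn_itv; rewrite divr_ge0 // ltW.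
have injN : {in S &, injective N}.
  have key y z : S y -> S z -> N y = N z -> ~ prec y z.
    move=> Sy Sz NE yz; have := sep _ _ Sy Sz yz.
    have /andP[+ _] := NP y; have /andP[_] := NP z.
    rewrite NE ltr_pdivrMr// ler_pdivlMr// -natr1 mulrDl mul1r; lra.
  move=> y z /set_mem Sy /set_mem Sz NE; apply: contrapT => yz.
  by case: (prec_total yz) => /key; apply.
rewrite -(eq_finite_set (inj_card_eq injN)).
apply: (@sub_finite_set _ _ `I_(Num.truncn e^-1).+1); last exact: finite_II.
move=> _ [y Sy <-] /=; rewrite ltnS.
by apply: le_truncn; rewrite ler_pdivrMr// mulVf ?gt_eqF.
Qed.

End LocallyFinite.

(** * Descent steps from a locally finite family of directions *)

Lemma descent_along (R : realType) (X : normedModType R) (g : X -> R)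
    (x w : X) (c : R) :
  (forall z, differentiable g z) ->
  (forall s, 0 <= s <= 1 -> c <= 'd g (x - s *: w) w) ->
  forall s, 0 <= s <= 1 -> g (x - s *: w) <= g x - s * c.
Proof.
move=> dg cw s /andP[s0 s1].
pose phi (t : R) := g (x - t *: w).
have dphi (t : R) : is_derive t 1 phi (- 'd g (x - t *: w) w).
  have dg' : derivable g (x - t *: w) (- w) by exact: diff_derivable.
  have E : (fun h : R => h^-1 *: ((phi \o shift t) (h *: 1) - phi t)) =
           (fun h : R => h^-1 *: ((g \o shift (x - t *: w)) (h *: - w)
                                  - g (x - t *: w))).
    apply/funext => h; rewrite /= /phi; congr (_ *: (g _ - _)).
    rewrite [h *: 1]mulr1 scalerDl opprD scalerN addrCA; congr (_ + _).
  apply: DeriveDef; first by rewrite /derivable E.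
  by rewrite /derive E -[lim _]/('D_(- w) g (x - t *: w)) deriveE// linearN.
have [t] : exists2 t, t \in `[0, s] & phi s - phi 0 = - 'd g (x - t *: w) w * (s - 0).
  apply: MVT_segment => //.
  by apply: derivable_within_continuous => t _; exact: ex_derive.
rewrite in_itv /= => /andP[t0 ts].
rewrite /phi scale0r !subr0 => /eqP; rewrite subr_eq => /eqP ->.
have := cw t; rewrite t0 (le_trans ts s1) => /(_ isT) ct.
have := ler_wpM2r s0 ct; lra.
Qed.

Lemma continuous_locally_finite_sum (R : realType) (T : choiceType)
    (X : topologicalType) (V : normedModType R) (F : T -> X -> V) :
  (forall y, continuous (F y)) ->
  (forall x : X, exists2 A : set T, finite_set A &
    \forall z \near x, forall y, ~ A y -> F y z = 0) ->
  continuous (fun x => \sum_(y \in [set: T]) F y x).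
Proof.
move=> cF lf x; have [A fA nA] := lf x.
(* The sum over all of [T] has the default value 0 for infinite supports; near [x] it is the genuine
   finite sum over [A]. *)
have E z : (forall y, ~ A y -> F y z = 0) ->
    \sum_(y \in [set: T]) F y z = \sum_(y <- finmap.enum_fset (fset_set A)) F y z.
  move=> Az; rewrite -fsbig_finite//; apply/esym/fsbig_widen => // y [_ nAy].
  exact: Az.
apply: (@cvg_trans _ ((fun z => \sum_(y <- finmap.enum_fset (fset_set A)) F y z) @ x)).
  by apply: near_eq_cvg; near=> z; rewrite E//; near: z.
rewrite E; last exact: nbhs_singleton nA.
elim: (finmap.enum_fset _) => [|y s IHs].
  by rewrite big_nil; under eq_fun do rewrite big_nil; exact: cvg_cst.
rewrite big_cons; under eq_fun do rewrite big_cons.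
by apply: cvgD => //; exact: cF.
Unshelve. all: by end_near. Qed.

(* If the [n]-th weight of [y] at [x] is positive, then the ball of centre [x]
   and radius [n.+1%:R^-1] lies where [v y] is a descent direction; this bounds
   the length of the [n]-th step. *)
Lemma pseudo_gradient_steps (R : realType) (X : normedModType R) (g : X -> R)
    (v : X -> X) (r : X -> R) (sigma : R) :
  0 <= sigma ->
  (forall x, differentiable g x) ->
  (forall y, `|v y| <= 1) -> (forall y, 0 <= r y <= 1) ->
  (forall y z, `|z - y| < r y -> sigma <= 'd g z (v y)) ->
  exists (w : nat -> X -> X) (theta : nat -> X -> R),
    [/\ forall n, continuous (w n) /\ continuous (theta n),
        forall n x, `|w n x| <= theta n x,
        forall n x s, 0 <= s <= 1 ->
          g (x - s *: w n x) <= g x - s * (sigma * theta n x) &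
        forall x, 0 < r x -> exists n, 0 < theta n x].
Proof.
move=> sigma0 dg v1 r01 vr.
pose f (y x : X) : R := Num.max 0 (r y - `|x - y|).
have f0 y x : 0 <= f y x by rewrite /f le_max lexx.
have f1 y x : f y x <= 1.
  rewrite /f ge_max ler01 /=; have /andP[_ ry] := r01 y.
  by rewrite (le_trans _ ry)// gerBl.
have flip y x z : f y x <= f y z + `|x - z|.
  rewrite /f ge_max addr_ge0 ?le_max ?lexx//=.
  have tri : `|z - y| <= `|x - z| + `|x - y|.
    by rewrite (distrC x z) (le_trans (ler_distD x _ _)).
  have : r y - `|z - y| <= Num.max 0 (r y - `|z - y|) by rewrite le_max lexx orbT.
  lra.
pose u := reduced f.
have u_lip := reduced_lip f1 flip; rewrite -/u in u_lip.
pose e (n : nat) : R := n.+1%:R^-1.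
have e0 n : 0 < e n by rewrite invr_gt0.
(* The reduced functions are locally finite only above a threshold, hence one field for each
   threshold [e n]; every point with [0 < r x] is moved by at least one of them. *)
pose c (n : nat) (y x : X) : R := Num.max 0 (u y x - e n).
have c0 n y x : 0 <= c n y x by rewrite /c le_max lexx.
have c_pos n y x : 0 < c n y x -> e n < u y x.
  by rewrite /c lt_max ltxx /= subr_gt0.
have c_eq0 n y x : ~ e n < u y x -> c n y x = 0.
  by move=> /negP; rewrite -leNgt => ?; rewrite /c max_l// subr_le0.
have cu y : continuous (u y).
  move=> x; apply/cvgrPdist_lt => d d0; near=> z.
  have zx : `|x - z| < d / 2 by near: z; apply: cvgr_dist_lt => //; lra.
  have := u_lip y x z; have := u_lip y z x; rewrite (distrC z x) ltr_norml; lra.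
have cc n y : continuous (c n y).
  move=> x; apply: (@continuous_max _ X (cst 0) (fun x => u y x - e n)).
    exact: cvg_cst.
  by apply: cvgB; [exact: cu|exact: cvg_cst].
have c_fin n (x : X) : exists2 A : set X, finite_set A &
    \forall z \near x, forall y, ~ A y -> c n y z = 0.
  exists [set y | e n / 2 < u y x].
    by apply: reduced_finite => //; rewrite divr_gt0.
  near=> z => y /= uyx; apply: c_eq0 => uyz; apply: uyx.
  have zx : `|x - z| < e n / 8.
    by near: z; apply: cvgr_dist_lt => //; rewrite divr_gt0.
  by have := u_lip y z x; rewrite (distrC z x); have := e0 n; lra.
pose W n (x : X) : X := \sum_(y \in [set: X]) c n y x *: v y.
pose q n (x : X) : R := \sum_(y \in [set: X]) c n y x.
have cW n : continuous (W n).
  apply: continuous_locally_finite_sum => [y x|x].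
    by apply: cvgZr_tmp; exact: cc.
  have [A fA nA] := c_fin n x; exists A => //.
  by apply: filterS nA => z nAz y /nAz ->; rewrite scale0r.
have cq n : continuous (q n).
  by apply: continuous_locally_finite_sum => [y x|x]; [exact: cc|exact: c_fin].
have WqE n x : exists s : seq X,
    W n x = \sum_(y <- s) c n y x *: v y /\ q n x = \sum_(y <- s) c n y x.
  have [A fA /nbhs_singleton nA] := c_fin n x.
  exists (finmap.enum_fset (fset_set A)).
  by split; rewrite -fsbig_finite//; apply/esym/fsbig_widen => // y [_ nAy] /=;
    rewrite nA// scale0r.
have q0 n x : 0 <= q n x.
  by have [s [_ ->]] := WqE n x; apply: sumr_ge0.
have Wq n x : `|W n x| <= q n x.
  have [s [-> ->]] := WqE n x; rewrite (le_trans (ler_norm_sum _ _ _))//.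
  apply: ler_sum => y _; rewrite normrZ ger0_norm//.
  by rewrite ler_piMr.
have m0 n x : 0 < Num.max 1 (q n x) by rewrite lt_max ltr01.
(* This factor caps the length of the step at [e n], so that the segment stays in each ball where a
   contributing [v y] is a descent direction. *)
pose k n x := e n / Num.max 1 (q n x).
have k0 n x : 0 < k n x by rewrite divr_gt0.
have ck n : continuous (k n).
  move=> x; apply: cvgM; first exact: cvg_cst.
  apply: cvgV; first by rewrite gt_eqF.
  apply: (@continuous_max _ X (cst 1) (q n)); first exact: cvg_cst.
  exact: cq.
have kqe n x : k n x * q n x <= e n.
  rewrite /k mulrAC -mulrA ler_piMr ?(ltW (e0 _))//.
  by rewrite ler_pdivrMr// mul1r le_max lexx orbT.
exists (fun n x => k n x *: W n x), (fun n x => k n x * q n x); split.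
- move=> n; split=> x; first by apply: cvgZ; [exact: ck|exact: cW].
  by apply: cvgM; [exact: ck|exact: cq].
- by move=> n x; rewrite normrZ gtr0_norm// ler_pM2l.
- move=> n x; apply: descent_along => // s /andP[s0 s1].
  set z := x - _; have zx : `|z - x| <= e n.
    rewrite /z addrC addKr normrN normrZ ger0_norm//.
    apply: (@le_trans _ _ `|k n x *: W n x|); first by rewrite ler_piMl.
    by rewrite (le_trans _ (kqe n x))// normrZ gtr0_norm// ler_pM2l.
  rewrite linearZ /= mulrCA ler_pM2l//.
  have [t [-> ->]] := WqE n x.
  rewrite linear_sum mulr_sumr; apply: ler_sum => y _.
  rewrite linearZ /= [sigma * _]mulrC.
  change (c n y x * sigma <= c n y x * 'd g z (v y)).
  have [->|cn0] := eqVneq (c n y x) 0; first by rewrite !mul0r.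
  have cn : 0 < c n y x by rewrite lt0r cn0 c0.
  rewrite ler_pM2l//; apply: vr.
  have := lt_le_trans (c_pos _ _ _ cn) (reduced_le f1 y x).
  rewrite /f lt_max ltNge (ltW (e0 n)) /=.
  by have := ler_distD x z y; lra.
- move=> x rx.
  have [|y uyx] := reduced_pos f1 (x := x).
    by exists x; rewrite /f subrr normr0 subr0 lt_max rx orbT.
  have [n en] : exists n, e n < u y x.
    exists (Num.truncn (u y x)^-1).
    by rewrite /e invf_plt ?posrE// truncnS_gt.
  exists n; rewrite mulr_gt0//.
  have cy : 0 < c n y x by rewrite /c lt_max subr_gt0 en orbT.
  suff : c n y x <= q n x by apply: lt_le_trans.
  rewrite /q.
  have [A fA /nbhs_singleton nA] := c_fin n x.
  have Ay : A y by apply: contrapT => /nA E; rewrite E ltxx in cy.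
  rewrite -(@fsbig_widen _ _ _ _ A) => [||z [_ /nA]]//.
  rewrite (fsbigD1 y)//= lerDl fsbig_finite; last exact: finite_setD.
  exact: sumr_ge0.
Unshelve. all: by end_near. Qed.

(** * Composing infinitely many descent steps *)

Section Descent.
Variables (R : realType) (X : completeNormedModType R) (g : X -> R).
Variables (w : nat -> X -> X) (theta : nat -> X -> R) (sigma a b : R).
Hypotheses (cg : continuous g) (sigma_gt0 : 0 < sigma).
Hypothesis cw : forall n, continuous (w n) /\ continuous (theta n).
Hypothesis w_theta : forall n x, `|w n x| <= theta n x.
Hypothesis descent : forall n x s, 0 <= s <= 1 ->
  g (x - s *: w n x) <= g x - s * (sigma * theta n x).
Hypothesis slab : forall x, a <= g x <= b -> exists n, 0 < theta n x.

(* [logn 2 k] takes every value infinitely often. *)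
Let step k := w (logn 2 k).

Fixpoint orbit_of (k : nat) (x : X) : X :=
  if k is k'.+1 then orbit_of k' x - step k' (orbit_of k' x) else x.

Let theta_ge0 n x : 0 <= theta n x.
Proof. exact: le_trans (normr_ge0 _) (w_theta n x). Qed.

Lemma descent_le n x s : 0 <= s <= 1 -> g (x - s *: w n x) <= g x.
Proof.
move=> s01; rewrite (le_trans (descent _ _ s01))// gerBl.
by case/andP: s01 => s0 _; rewrite !mulr_ge0// ltW.
Qed.

Lemma orbit_of_decrease k x :
  g (orbit_of k.+1 x) <= g (orbit_of k x) - sigma * theta (logn 2 k) (orbit_of k x).
Proof.
have := @descent (logn 2 k) (orbit_of k x) 1; rewrite scale1r mul1r; apply.
by rewrite ler01 lexx.
Qed.

Lemma orbit_of_nonincreasing x k m : (k <= m)%N ->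
  g (orbit_of m x) <= g (orbit_of k x).
Proof.
move=> /subnK <-; elim: (m - k)%N => [//|n IHn].
rewrite addSn (le_trans (orbit_of_decrease _ _))// (le_trans _ IHn)//.
by rewrite gerBl mulr_ge0// ltW.
Qed.

Lemma continuous_orbit_of k : continuous (orbit_of k).
Proof.
elim: k => [|k IHk] x; first exact: cvg_id.
apply: cvgB; first exact: IHk.
exact: (continuous_comp1 (cw _).1 IHk).
Qed.

(* Otherwise the steps would be summable, and the limit of the orbit would be
   a point of the slab where no step is possible. *)
Lemma orbit_of_exit x : g x <= b -> exists k, g (orbit_of k x) < a.
Proof.
move=> gxb; apply: contrapT => /forallNP noexit.
have ga k : a <= g (orbit_of k x) by rewrite leNgt; apply/negP; exact: noexit.
pose s k := theta (logn 2 k) (orbit_of k x).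
have s0 k : 0 <= s k by exact: theta_ge0.
have sum_s n : sigma * series s n <= g x - g (orbit_of n x).
  elim: n => [|n IHn]; first by rewrite /series /= big_geq// mulr0 subrr.
  rewrite /series /= big_nat_recr//= mulrDr.
  have := orbit_of_decrease n x; rewrite -/(s n); move: IHn; rewrite /series /=.
  lra.
have cs : cvgn (series s).
  apply: nondecreasing_is_cvgn.
    by apply/nondecreasing_seqP => n; rewrite /series /= big_nat_recr//= lerDl.
  exists ((g x - a) / sigma) => _ [n _ <-].
  rewrite ler_pdivlMr// mulrC (le_trans (sum_s n))//.
  by rewrite lerD2l lerN2.
pose d k := orbit_of k.+1 x - orbit_of k x.
have ds k : `|d k| <= s k by rewrite /d /= addrC addKr normrN; exact: w_theta.
have cd : cvgn (series d).
  by apply: normed_cvg; apply: series_le_cvg cs => // n; rewrite /=.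
have dE n : series d n = orbit_of n x - x.
  elim: n => [|n IHn]; first by rewrite /series /= big_geq// subrr.
  by move: IHn; rewrite /series /= big_nat_recr//= => ->; rewrite /d /= addrC addrA subrK.
pose y := limn (series d) + x.
have oy : orbit_of n x @[n --> \oo] --> y.
  rewrite (_ : (fun n => orbit_of n x) = (fun n => series d n + x)).
    by apply: cvgD; [exact: cd|exact: cvg_cst].
  by apply/funext => n; rewrite dE subrK.
have gy : g (orbit_of n x) @[n --> \oo] --> g y.
  by apply: (continuous_cvg _ _ oy); exact: cg.
have [|n ny] := slab (x := y).
  apply/andP; split.
    rewrite -(cvg_lim _ gy)//; apply: limr_ge; first by apply/cvg_ex; exists (g y).
    exact: nearW.
  rewrite -(cvg_lim _ gy)//; apply: limr_le; first by apply/cvg_ex; exists (g y).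
  by apply: nearW => n; rewrite (le_trans _ gxb)// (@orbit_of_nonincreasing x 0).
have ty : theta n (orbit_of k x) @[k --> \oo] --> theta n y.
  by apply: (continuous_cvg _ _ oy); exact: (cw n).2.
have s_cvg0 := cvg_series_cvg_0 cs.
have [K _ HK] : \forall k \near \oo, theta n y / 2 < theta n (orbit_of k x) /\
    s k < theta n y / 2.
  near=> k; split; near: k.
    by apply: (cvgr_gt _ ty); lra.
  by apply: (cvgr_lt _ s_cvg0); lra.
(* An index beyond [K] of 2-adic valuation [n]: the [n]-th field is used there, so that the two
   bounds of [HK] contradict each other. *)
have nK : logn 2 (2 ^ n * (2 * K).+1) = n.
  rewrite lognM ?expn_gt0// pfactorK// -[RHS]addn0; congr addn.
  by apply: logn_coprime; rewrite -[2%N]/(2 ^ 1)%N coprime2n /= mul2n odd_double.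
have [|t1 t2] := HK (2 ^ n * (2 * K).+1)%N.
  apply: (@leq_trans (2 * K).+1); first by rewrite leqW// mul2n -addnn leq_addr.
  by rewrite leq_pmull// expn_gt0.
by move: t2; rewrite /s nK ltNge (ltW t1).
Unshelve. all: by end_near. Qed.

Variables (a' b' : R).
Hypotheses (aa' : a < a') (bb' : b' < b).

(* The weights stop an orbit below the slab, so that only finitely many of the
   steps composed in [flow] matter near a given point. *)
Let weight k x := clamp01 ((g (orbit_of k x) - a) / (a' - a)) *
                  clamp01 ((b - g x) / (b - b')).

Let weight01 k x : 0 <= weight k x <= 1.
Proof.
by rewrite /weight mulr_ge0 ?clamp01_ge0//= mulr_ile1// ?clamp01_ge0 ?clamp01_le1.
Qed.

Let continuous_weight k : continuous (weight k).
Proof.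
have c1 : continuous (fun x => (g (orbit_of k x) - a) / (a' - a)).
  move=> x; apply: cvgM; last exact: cvg_cst.
  apply: cvgB; last exact: cvg_cst.
  exact: (continuous_comp1 cg (@continuous_orbit_of k)).
have c2 : continuous (fun x => (b - g x) / (b - b')).
  move=> x; apply: cvgM; last exact: cvg_cst.
  by apply: cvgB; [exact: cvg_cst|exact: cg].
move=> x; apply: cvgM.
  exact: (continuous_comp1 (@continuous_clamp01 R) c1).
exact: (continuous_comp1 (@continuous_clamp01 R) c2).
Qed.

Let flow := fix flow (k : nat) (z : R * X) : X :=
  if k is k'.+1
  then flow k' z - (clamp01 z.1 * weight k' z.2) *: step k' (flow k' z)
  else z.2.

Let continuous_flow k : continuous (flow k).
Proof.
elim: k => [|k IHk] z; first exact: continuous_snd.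
apply: cvgB; first exact: IHk.
apply: cvgZ; last exact: (continuous_comp1 (cw _).1 IHk).
apply: cvgM.
  exact: (continuous_comp1 (@continuous_clamp01 R) (@continuous_fst _ _)).
exact: (continuous_comp1 (@continuous_weight k) (@continuous_snd _ _)).
Qed.

Let flow_decrease k m z : (k <= m)%N -> g (flow m z) <= g (flow k z).
Proof.
move=> /subnK <-; elim: (m - k)%N => [//|n IHn].
rewrite addSn (le_trans _ IHn)//=; apply: descent_le.
have /andP[? ?] := weight01 (n + k) z.2.
by rewrite mulr_ge0 ?clamp01_ge0//= mulr_ile1// ?clamp01_ge0 ?clamp01_le1.
Qed.

Let flow0 k x : flow k (0, x) = x.
Proof.
elim: k => [//|k IHk]; rewrite /= IHk clamp01_le0// mul0r scale0r subr0.
by [].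
Qed.

(** If [g x <= b], the orbits of all nearby points are below [a] from some index on, which kills the
    first factor of the weight; above [b] the second factor vanishes. *)
Let flow_stationary (x : X) : exists m, \forall y \near x,
  forall k, (m <= k)%N -> weight k y = 0.
Proof.
have [gxb|bgx] := leP (g x) b.
  have [m gm] := orbit_of_exit gxb; exists m.
  have cgm : continuous (fun y => g (orbit_of m y)).
    exact: (continuous_comp1 cg (@continuous_orbit_of m)).
  near=> y; move=> k mk.
  have gy : g (orbit_of m y) < a by near: y; apply: (cvgr_lt _ (cgm x)).
  rewrite /weight clamp01_le0 ?mul0r//.
  rewrite pmulr_lle0 ?invr_gt0 ?subr_gt0// subr_le0 ltW//.
  exact: le_lt_trans (orbit_of_nonincreasing y mk) gy.
have cgx : g z @[z --> x] --> g x by exact: cg.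
exists 0%N; near=> y; move=> k _.
have gy : b < g y by near: y; apply: (cvgr_gt _ cgx).
rewrite /weight [X in _ * X]clamp01_le0 ?mulr0//.
by rewrite pmulr_lle0 ?invr_gt0 ?subr_gt0// subr_le0 ltW.
Unshelve. all: by end_near. Qed.

Lemma descent_deformation : exists h : R * X -> X,
  [/\ continuous h, forall x, h (0, x) = x,
      forall t x, g (h (t, x)) <= g x &
      forall x, g x <= b' -> g (h (1, x)) <= a'].
Proof.
have /choice[m mP] : forall x, exists m, forall k, (m <= k)%N -> weight k x = 0.
  by move=> x; have [m /nbhs_singleton] := flow_stationary x; exists m.
have stable n t x : (forall k, (n <= k)%N -> weight k x = 0) ->
    forall k, (n <= k)%N -> flow k (t, x) = flow n (t, x).
  move=> nx k /subnK <-; elim: (k - n)%N => [//|j IHj].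
  by rewrite addSn /= nx ?leq_addl// mulr0 scale0r subr0.
(* The index [m] is chosen pointwise, without continuity; as any later index gives the same value,
   [h] is locally one of the continuous [flow n]. *)
pose h (z : R * X) := flow (m z.2) z.
have hE n t x : (forall k, (n <= k)%N -> weight k x = 0) ->
    forall k, (n <= k)%N -> h (t, x) = flow k (t, x).
  move=> nx k nk; rewrite /h /= -(stable _ t _ (mP x) (maxn (m x) k)) ?leq_maxl//.
  rewrite (stable _ t _ nx (maxn _ _)) ?(leq_trans nk (leq_maxr _ _))//.
  by rewrite (stable _ t _ nx k).
exists h; split.
- move=> [t x]; have [n nx] := flow_stationary x.
  have hx : h (t, x) = flow n (t, x).
    by apply: hE (leqnn n) => //; exact: (nbhs_singleton nx).
  rewrite /continuous_at hx.
  have cf : flow n z @[z --> (t, x)] --> flow n (t, x) by exact: continuous_flow.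
  apply: cvg_trans cf.
  apply: near_eq_cvg; near=> z; rewrite [z]surjective_pairing.
  apply/esym/(hE n) => //; near: z.
  exact: (cvg_snd nx).
- by move=> x; exact: flow0.
- by move=> t x; exact: (@flow_decrease 0).
- move=> x gxb'.
  have ex : exists k, g (orbit_of k x) < a'.
    have [|k gk] := @orbit_of_exit x; first by rewrite (le_trans gxb')// ltW.
    by exists k; exact: lt_trans aa'.
  have [k gk kmin] := ex_minnP ex.
  (* Before the first index at which the orbit is below [a'], both factors of the weight are 1, so
     that at time 1 the flow follows the orbit. *)
  have kE j : (j <= k)%N -> flow j (1, x) = orbit_of j x.
    elim: j => [//|j IHj] jk; rewrite /= IHj; last exact: ltnW.
    rewrite clamp01_ge1// mul1r /weight !clamp01_ge1 ?mulr1 ?scale1r//.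
      by rewrite ler_pdivlMr ?subr_gt0// mul1r lerD2l lerN2.
    rewrite ler_pdivlMr ?subr_gt0// mul1r lerD2r leNgt.
    by apply/negP => /kmin; rewrite leqNgt jk.
  rewrite (hE (maxn k (m x)) 1 x _ (maxn k (m x)))//.
    rewrite (le_trans (flow_decrease _ (leq_maxl _ _)))// kE// ltW//.
  by move=> j jk; apply: mP; rewrite (leq_trans _ jk)// leq_maxr.
Unshelve. all: by end_near. Qed.

End Descent.

(** * Dual norm and differentials of slices *)

Section DualNorm.
Variables (R : realType) (V : normedModType R).

Lemma dual_norm_ge0 (u : {linear V -> R}) : (0 <= dual_norm u)%E.
Proof.
apply: ereal_sup_ubound; exists 0; first by rewrite /= normr0.
by rewrite linear0 normr0.
Qed.

Lemma dual_norm_le (u : {linear V -> R}) (e : R) :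
  (forall v, `|v| <= 1 -> `|u v| <= e) -> (dual_norm u <= e%:E)%E.
Proof. by move=> ue; apply: ge_ereal_sup => _ [v v1 <-]; rewrite lee_fin ue. Qed.

Lemma linear_unit_ball_le (u : {linear V -> R}) (e : R) :
  (forall v, `|v| <= 1 -> `|u v| <= e) -> forall v, `|u v| <= e * `|v|.
Proof.
move=> ue v; have [->|v0] := eqVneq v 0; first by rewrite linear0 !normr0 mulr0.
have nv : 0 < `|v| by rewrite normr_gt0.
have := ue (`|v|^-1 *: v); rewrite linearZ /= normrZ normfV normr_id mulVf ?gt_eqF//.
move=> /(_ (lexx _)); change (`| `|v|^-1 * u v| <= e -> `|u v| <= e * `|v|).
by rewrite normrM normfV normr_id mulrC ler_pdivrMr.
Qed.

Lemma C1_near (g : V -> R) : C1 g -> forall p e, 0 < e ->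
  \forall q \near p, forall u, `|'d g q u - 'd g p u| <= e * `|u|.
Proof.
move=> [_ cg] p e e0.
have : \forall q \near p, (dual_norm ('d g q \- 'd g p)%R < e%:E)%E.
  apply: (cg p [set y | (y < e%:E)%E]); apply: open_nbhs_nbhs; split.
    exact: open_ereal_lt_ereal.
  by rewrite /= lte_fin.
apply: filterS => q qe; apply: (@linear_unit_ball_le ('d g q \- 'd g p)) => v v1.
rewrite -lee_fin (le_trans _ (ltW qe))//.
by apply: ereal_sup_ubound; exists v.
Qed.

End DualNorm.

Section Slice.
Variables (R : realType) (X : completeNormedModType R) (f : R * X -> R).
Hypothesis fC1 : C1 f.

Lemma differentiable_slice l x : differentiable (slice f l) x.
Proof.
apply: (@differentiable_comp _ _ _ _ (fun x => (l, x)) f); last exact: fC1.1.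
apply: (@differentiable_pair _ _ _ _ (cst l) id).
  exact: differentiable_cst.
exact: ex_diff.
Qed.

Lemma diff_slice l x u : 'd (slice f l) x u = 'd f (l, x) (0, u).
Proof.
rewrite -[LHS]deriveE; last exact: differentiable_slice.
rewrite -[RHS]deriveE; last exact: fC1.1.
have E : (fun h : R => h^-1 *: ((slice f l \o shift x) (h *: u) - slice f l x)) =
         (fun h => h^-1 *: ((f \o shift (l, x)) (h *: (0, u)) - f (l, x))).
  apply/funext => h; rewrite /= /slice; congr (_ *: (f _ - _)).
  by transitivity (h *: (0 : R) + l, h *: u + x); rewrite // scaler0 add0r.
by rewrite /derive E.
Qed.

Lemma slice_near l x e : 0 < e ->
  \forall z \near x, forall u,
    `|'d (slice f l) z u - 'd (slice f l) x u| <= e * `|u|.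
Proof.
move=> e0; have cl : (fun z : X => (l, z)) @ x --> (l, x).
  by apply: (@cvg_pair _ _ _ _ (nbhs l) (nbhs x) _ _ _ (cst l) id);
    [exact: cvg_cst|exact: cvg_id].
have : \forall z \near x, forall u, `|'d f (l, z) u - 'd f (l, x) u| <= e * `|u|.
  exact: (cl _ (C1_near fC1 (l, x) e0)).
apply: filterS => z H u.
rewrite !diff_slice (le_trans (H _))// ler_wpM2l ?(ltW e0)//.
by rewrite prod_normE /= normr0 ge_max normr_ge0 lexx.
Qed.

End Slice.

(** * Pushing down through regular values *)

Section Regular.
Variables (R : realType) (X : completeNormedModType R) (g : X -> R).
Hypothesis dg : forall x, differentiable g x.
Hypothesis g_near : forall x e, 0 < e ->
  \forall z \near x, forall u, `|'d g z u - 'd g x u| <= e * `|u|.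
Hypothesis g_PS : forall (c : R) (x : nat -> X),
  g (x n) @[n --> \oo] --> c -> dual_norm ('d g (x n)) @[n --> \oo] --> 0%E ->
  exists2 k : nat -> nat, increasing_seq k & cvgn (x \o k).

Let cg : continuous g.
Proof. by move=> x; exact: differentiable_continuous. Qed.

(** Otherwise there is a Palais-Smale sequence at level [c], and the limit of a subsequence is a
    critical point at that level. *)
Lemma regular_value_steep c :
  (forall x, g x = c -> 'd g x <> cst 0 :> (X -> R)) ->
  exists n : nat, forall x, `|g x - c| < n.+1%:R^-1 ->
    exists2 v, `|v| <= 1 & n.+1%:R^-1 <= 'd g x v.
Proof.
move=> reg; apply: contrapT => /forallNP H.
have /choice[x xP] : forall n : nat, exists x, `|g x - c| < n.+1%:R^-1 /\
    forall v, `|v| <= 1 -> 'd g x v < n.+1%:R^-1.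
  move=> n; have /existsNP[x /not_implyP[xc /forall2NP Hx]] := H n; exists x.
  by split=> // v v1; have [//|/negP] := Hx v; rewrite -ltNge.
have xn n v : `|v| <= 1 -> `|'d g (x n) v| <= n.+1%:R^-1.
  move=> v1; rewrite ler_norml (ltW ((xP n).2 _ v1)) andbT lerNl.
  by rewrite -linearN ltW// ; apply: (xP n).2; rewrite normrN.
have gx : g (x n) @[n --> \oo] --> c.
  apply/cvgrPdist_lt => e e0; near=> n.
  rewrite distrC (lt_trans (xP n).1)//.
  by near: n; apply: (cvgr_lt _ (@cvg_harmonic R)).
have dx : dual_norm ('d g (x n)) @[n --> \oo] --> 0%E.
  apply: (@squeeze_cvge _ _ _ _ (fun=> 0%E) _ (fun n => (n.+1%:R^-1)%:E)).
  - by near=> n; rewrite dual_norm_ge0 dual_norm_le//; exact: xn.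
  - exact: cvg_cst.
  - by apply: cvg_EFin; [exact: nearW|exact: (@cvg_harmonic R)].
have [k kinc /cvg_ex[y xy]] := g_PS gx dx.
have k_ge n : (n <= k n)%N.
  elim: n => // n IHn; rewrite (leq_ltn_trans IHn)// ltnNge.
  by have := kinc n.+1 n; rewrite /Order.le /= ltnn => ->.
have gk : g ((x \o k) n) @[n --> \oo] --> g y.
  by apply: (continuous_cvg _ _ xy); exact: cg.
have koo : k n @[n --> \oo] --> \oo.
  by move=> A [N _ NA]; exists N => // n Nn; apply: NA => /=; exact: leq_trans (k_ge n).
have gyc : g y = c.
  by apply: (cvg_unique _ gk) => //; exact: (cvg_comp _ _ koo gx).
apply: (reg y gyc); apply/funext => u /=; apply/eqP.
rewrite -normr_le0; apply/ler_addgt0Pr => e e0; rewrite add0r.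
have e1 : 0 < e / 2 / (1 + `|u|) by rewrite !divr_gt0// ltr_pwDl.
have H1 : \forall n \near \oo, forall u', `|'d g (x (k n)) u' - 'd g y u'| <=
    e / 2 / (1 + `|u|) * `|u'|.
  exact: (xy _ (g_near y e1)).
near \oo => n.
have n1 : n.+1%:R^-1 < e / 2 / (1 + `|u|).
  by near: n; apply: (cvgr_lt _ (@cvg_harmonic R)).
have h1 : `|'d g (x (k n)) u - 'd g y u| <= e / 2 / (1 + `|u|) * `|u|.
  by near: n; apply: filterS H1 => n.
have h2 := linear_unit_ball_le (xn (k n)).
have h3 : (k n).+1%:R^-1 * `|u| <= e / 2 / (1 + `|u|) * `|u|.
  rewrite ler_wpM2r// (le_trans _ (ltW n1))// lef_pV2 ?posrE//.
  by rewrite ler_nat ltnS k_ge.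
have h4 : e / 2 / (1 + `|u|) * `|u| <= e / 2.
  rewrite mulrAC ler_pdivrMr ?ltr_pwDl// ler_wpM2l ?lerDr//.
  by rewrite divr_ge0// ltW.
rewrite (_ : 'd g y u = 'd g (x (k n)) u - ('d g (x (k n)) u - 'd g y u)).
  rewrite (le_trans (ler_normB _ _))// [leRHS](splitr e).
  exact: lerD (le_trans (h2 u) (le_trans h3 h4)) (le_trans h1 h4).
by rewrite opprB addrC subrK.
Unshelve. all: by end_near. Qed.

(** Compactness of [[a, b]] makes the slope uniform over the levels. *)
Lemma regular_slab_steep a b :
  (forall x, a <= g x <= b -> 'd g x <> cst 0 :> (X -> R)) ->
  exists n : nat, forall x, a <= g x <= b ->
    exists2 v, `|v| <= 1 & n.+1%:R^-1 <= 'd g x v.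
Proof.
move=> reg.
have /compact_near_coveringP/(_ nat \oo (fun n c => forall x, g x = c ->
  exists2 v, `|v| <= 1 & n.+1%:R^-1 <= 'd g x v) _) := @segment_compact R a b.
case=> [c|N _ NP].
  rewrite /= in_itv /= => abc.
  have [|n nP] := @regular_value_steep c; first by move=> x gx; apply: reg; rewrite gx.
  near=> d m; move=> x gx.
  have cd : `|c - d| < n.+1%:R^-1.
    by near: d; apply: cvgr_dist_lt; rewrite ?invr_gt0//; exact: cvg_id.
  have nm : (n <= m)%N by near: m; exact: nbhs_infty_ge.
  have [|v v1 vn] := nP x; first by rewrite gx distrC.
  by exists v => //; rewrite (le_trans _ vn)// lef_pV2 ?posrE// ler_nat ltnS.
by exists N => x gx; apply: (NP N (leqnn N) (g x)) => //; rewrite /= in_itv.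
Unshelve. all: by end_near. Qed.

Lemma regular_pushable y rho : 0 < rho ->
  (forall x, y - rho <= g x <= y + rho -> 'd g x <> cst 0 :> (X -> R)) ->
  pushable g y (rho / 2).
Proof.
move=> rho0 /regular_slab_steep[n steep].
pose sigma : R := n.+1%:R^-1; have s0 : 0 < sigma by rewrite invr_gt0.
(* In the slab, continuity of the differential keeps half of the slope on a small ball. Outside of
   it, radius 0 makes the last condition void. *)
have /choice[vr vrP] : forall x, exists vr : X * R,
    [/\ `|vr.1| <= 1, 0 <= vr.2 <= 1,
      (y - rho <= g x <= y + rho -> 0 < vr.2) &
      forall z, `|z - x| < vr.2 -> sigma / 2 <= 'd g z vr.1].
  move=> x; have [gx|ngx] := pselect (y - rho <= g x <= y + rho); last first.
    exists (0, 0); split=> //=; rewrite ?normr0 ?lexx ?ler01// => z.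
    by rewrite ltNge normr_ge0.
  have [v v1 sv] := steep x gx.
  have /nbhs_ballP[d /= d0 dP] := @g_near x (sigma / 2) (divr_gt0 s0 (ltr0Sn R 1)).
  exists (v, Num.min d 1); split=> //=.
  - by rewrite le_min ge_min lexx orbT (ltW d0) ler01.
  - by rewrite lt_min d0 ltr01.
  - move=> z; rewrite lt_min => /andP[zd _].
    have : ball x d z by rewrite -ball_normE /= distrC.
    move=> /dP /(_ v); rewrite ler_norml => /andP[+ _].
    have : sigma / 2 * `|v| <= sigma / 2 by rewrite ler_piMr// divr_ge0// ltW.
    by rewrite -/sigma in sv *; lra.
have s20 : 0 < sigma / 2 by rewrite divr_gt0.
have [w [theta [cw wt desc pos]]] := @pseudo_gradient_steps R X g (fst \o vr)
  (snd \o vr) (sigma / 2) (ltW s20) dg (fun x => let: And4 h _ _ _ := vrP x in h)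
  (fun x => let: And4 _ h _ _ := vrP x in h) (fun x => let: And4 _ _ _ h := vrP x in h).
have [|||h [ch h0 hg h1]] := @descent_deformation R X g w theta (sigma / 2)
    (y - rho) (y + rho) cg s20 cw wt desc _ (y - rho / 2) (y + rho / 2).
- by move=> x gx; apply: pos; have [_ _ + _] := vrP x; exact.
- lra.
- lra.
- by exists h; split.
Qed.

End Regular.
(** * Dependence of the sublevel sets on the parameter *)

(** At the last time where [psi <= 0], [psi] vanishes and decreases, which contradicts its
    positivity afterwards. The derivative is constrained at zeros only, where the values of [f] will
    be under control. *)
Lemma no_upward_crossing (R : realType) (psi dpsi : R -> R) (a b : R) :
  a <= b -> (forall t : R, is_derive t (1 : R) psi (dpsi t)) -> psi a <= 0 ->
  (forall t, a <= t <= b -> psi t = 0 -> dpsi t < 0) -> psi b <= 0.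
Proof.
move=> ab dP psia cross; rewrite leNgt; apply/negP => psib.
have cpsi : continuous psi.
  move=> t; apply: differentiable_continuous; apply/derivable1_diffP.
  exact: (@ex_derive _ _ _ _ _ _ _ (dP t)).
pose S := [set t | a <= t <= b /\ psi t <= 0].
have Sa : S a by rewrite /S /= lexx ab.
have supS : has_sup S.
  by split; [exists a|exists b => t [/andP[]]].
have ac : a <= sup S by apply: ub_le_sup => //; exact: supS.2.
have cb : sup S <= b by apply: ge_sup; [exists a|move=> t [/andP[]]].
set c := sup S in ac cb.
have psic : psi c <= 0.
  rewrite leNgt; apply/negP => psic.
  have /nbhs_ballP[e /= e0 He] : \forall t \near c, 0 < psi t.
    by apply: (cvgr_gt _ (cpsi c)).
  have [t St] := sup_adherent e0 supS; rewrite -/c => ct.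
  have tc : t <= c by apply: ub_le_sup => //; exact: supS.2.
  have /He : ball c e t by rewrite -ball_normE /= ger0_norm ?subr_ge0//; lra.
  by rewrite ltNge St.2.
have {}cb : c < b.
  by rewrite lt_neqAle cb andbT; apply: contraTneq psib => <-; rewrite -leNgt.
have after t : c < t <= b -> 0 < psi t.
  move=> /andP[ct tb]; rewrite ltNge; apply/negP => psit.
  suff : t <= c by rewrite leNgt ct.
  apply: ub_le_sup; first exact: supS.2.
  by split=> //; rewrite tb (le_trans ac (ltW ct)).
have [psic0|psic0] := eqVneq (psi c) 0; last first.
  have {psic0}psic : psi c < 0 by rewrite lt_neqAle psic0.
  have /nbhs_ballP[e /= e0 He] : \forall t \near c, psi t < 0.
    by apply: (cvgr_lt _ (cpsi c)).
  have m0 : 0 < Num.min (e / 2) (b - c) by rewrite lt_min divr_gt0//= subr_gt0.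
  have m1 : Num.min (e / 2) (b - c) <= e / 2 by rewrite ge_min lexx.
  have m2 : Num.min (e / 2) (b - c) <= b - c by rewrite ge_min lexx orbT.
  have /He : ball c e (c + Num.min (e / 2) (b - c)).
    by rewrite -ball_normE /= opprD addrA subrr sub0r normrN gtr0_norm//; lra.
  by rewrite ltNge ltW// after//; lra.
have dc0 : dpsi c < 0 by apply: cross => //; rewrite ac ltW.
have [dc dcE] := dP c.
have /nbhs_ballP[e /= e0 He] :
    \forall h \near (0 : R)^', h^-1 *: ((psi \o shift c) (h *: 1) - psi c) < 0.
  by apply: (cvgr_lt _ dc); rewrite -[lim _]/('D_1 psi c) dcE.
have m0 : 0 < Num.min (e / 2) (b - c) by rewrite lt_min divr_gt0//= subr_gt0.
have m1 : Num.min (e / 2) (b - c) <= e / 2 by rewrite ge_min lexx.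
have m2 : Num.min (e / 2) (b - c) <= b - c by rewrite ge_min lexx orbT.
set m := Num.min _ _ in m0 m1 m2.
have mn0 : m != 0 by rewrite gt_eqF.
have /He /(_ mn0) : ball 0 e m.
  by rewrite -ball_normE /= sub0r normrN gtr0_norm//; lra.
rewrite psic0 subr0 /= [_ *: 1]mulr1.
have pos : 0 < psi (m + c) by apply: after; lra.
change (m^-1 * psi (m + c) < 0 -> False).
by rewrite ltNge ltW// mulr_gt0// invr_gt0.
Qed.

Section Interleaving.
Variables (R : realType) (X : completeNormedModType R) (f : R * X -> R).
Hypothesis fC1 : C1 f.

Lemma is_derive_partial1 x l : is_derive l (1 : R) (fun t => f (t, x)) (partial1 f (l, x)).
Proof.
have /derivable1_diffP d : differentiable (fun t : R => f (t, x)) l.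
  apply: (@differentiable_comp _ _ _ _ (fun t : R => (t, x)) f); last exact: fC1.1.
  apply: (@differentiable_pair _ _ _ _ id (cst x)); first exact: ex_diff.
  exact: differentiable_cst.
by apply: DeriveDef => //; rewrite /partial1 derive1E.
Qed.

(** The bound on [partial1] is available only while [f] stays in the window. Comparison with a line
    of slope [L] larger than [M] uses it only where the two meet, and the line stays in the
    window. *)
Lemma sublevel_drift (N M L l m y : R) (x : X) :
  (forall p : R * X, -1 <= p.1 <= 1 -> - N <= f p <= N -> `|partial1 f p| <= M) ->
  M < L -> 0 <= L -> -1 <= l <= 1 -> -1 <= m <= 1 ->
  - N <= y -> y + L * `|l - m| <= N ->
  f (l, x) <= y -> f (m, x) <= y + L * `|l - m|.
Proof.
move=> fM ML L0 l1 m1 yN yN' fl.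
have key (phi dphi : R -> R) (c d : R) : c <= d -> d - c = `|l - m| ->
    (forall t : R, is_derive t (1 : R) phi (dphi t)) -> phi c <= y ->
    (forall t, c <= t <= d -> - N <= phi t <= N -> `|dphi t| <= M) ->
    phi d <= y + L * `|l - m|.
  move=> cd lmE dP phic phiM; rewrite -lmE in yN' *.
  pose psi (t : R) := phi t - (y + L * (t - c)).
  have dpsi (t : R) : is_derive t (1 : R) psi (dphi t - L).
    have H : is_derive t (1 : R) (cst y + L \*: (id - cst c)) (0 + L *: (1 - 0)).
      by apply: is_deriveD.
    have -> : L = 0 + L *: (1 - 0) by rewrite subr0 add0r [_ *: _]mulr1.
    exact: (is_deriveB (dP t) H).
  suff : psi d <= 0 by rewrite /psi subr_le0.
  apply: (no_upward_crossing cd dpsi) => [|t /andP[ct td]].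
    by rewrite /psi subrr mulr0 addr0 subr_le0.
  move=> /eqP; rewrite subr_eq0 => /eqP ft; rewrite subr_lt0.
  apply: le_lt_trans ML; apply: le_trans (ler_norm _) _; apply: phiM.
    by rewrite ct td.
  have Lt : 0 <= L * (t - c) by rewrite mulr_ge0// subr_ge0.
  have : L * (t - c) <= L * (d - c) by rewrite ler_wpM2l// lerD2r.
  by rewrite ft; lra.
have [lm|/ltW ml] := leP l m.
  apply: (key (fun t => f (t, x)) (fun t => partial1 f (t, x)) l m) => //.
  - by rewrite distrC ger0_norm// subr_ge0.
  - by move=> t; exact: is_derive_partial1.
  - by move=> t ltm ft; apply: fM => //=; lra.
(* The case [m <= l] follows by reflecting the parameter. *)
have := key (fun t => f (- t, x)) (fun t => - partial1 f (- t, x)) (- l) (- m).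
rewrite !opprK => /(_ _ _ _ fl); apply.
- by rewrite lerN2.
- by rewrite addrC ger0_norm// subr_ge0.
- move=> t; have := is_derive_partial1 x (- t); rewrite -[- partial1 _ _]mulrN1.
  by move=> H; apply: (@is_derive1_comp _ (fun s => f (s, x)) -%R).
- by move=> t lm ft; rewrite normrN; apply: fM => //=; lra.
Qed.

End Interleaving.
(** * Separation in the plane *)

(* A discrete form of the fact that two disjoint closed sets, none of which
   separates two points of a simply connected domain, do not separate them
   together.  The parity of the number of edges joining [G] to [K] is the same
   on all the rows of the grid. *)
Section Grid.
Variables (n m : nat) (N K F G : nat -> nat -> bool).
Hypothesis cover : forall i j, (i <= n)%N -> (j <= m)%N ->
  [|| N i j, K i j | F i j].
Hypothesis G_N : forall i j, G i j -> N i j.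
Hypothesis N_K : forall i j, N i j -> ~~ K i j.
Hypothesis K_F : forall i j i' j', (i <= i'.+1)%N -> (i' <= i.+1)%N ->
  (j <= j'.+1)%N -> (j' <= j.+1)%N -> K i j -> ~~ F i' j'.
Hypothesis G_horizontal : forall i j, (i < n)%N -> (j <= m)%N ->
  N i j -> N i.+1 j -> G i j = G i.+1 j.
Hypothesis G_vertical : forall i j, (i <= n)%N -> (j < m)%N ->
  N i j -> N i j.+1 -> G i j = G i j.+1.
Hypothesis K_left : forall j, (j <= m)%N -> ~~ K 0%N j.
Hypothesis K_right : forall j, (j <= m)%N -> ~~ K n j.
Hypothesis K_top : forall i, (i <= n)%N -> ~~ K i m.
Hypothesis F_bottom : forall i, (i <= n)%N -> ~~ F i 0%N.

Let crossing i j i' j' := (G i j && K i' j') || (K i j && G i' j').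

Let crossing_noK i j i' j' : ~~ K i j -> ~~ K i' j' -> crossing i j i' j' = false.
Proof. by rewrite /crossing => /negbTE -> /negbTE ->; rewrite andbF. Qed.

Let G_K i j : G i j -> K i j = false.
Proof. by move=> /G_N /N_K /negbTE. Qed.

(** Away from [F] a vertex outside [G] is in [K] or neutral, and the latter is not adjacent to [G];
    hence an edge crosses exactly when [G] changes along it. *)
Let crossing_noF i j i' j' : [|| N i j, K i j | F i j] ->
  [|| N i' j', K i' j' | F i' j'] -> ~~ F i j -> ~~ F i' j' ->
  (N i j -> N i' j' -> G i j = G i' j') -> crossing i j i' j' = G i j (+) G i' j'.
Proof.
move=> v w /negbTE f /negbTE f' adj; rewrite f orbF in v; rewrite f' orbF in w.
rewrite /crossing.
have [g|ng] := boolP (G i j); have [g'|ng'] := boolP (G i' j') => /=.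
- by rewrite !G_K.
- rewrite andbF orbF; case/orP: w => [w|//].
  by move: ng'; rewrite -(adj (G_N g) w) g.
- rewrite andbT; case/orP: v => [v|//].
  by move: ng; rewrite (adj v (G_N g')) g'.
- by rewrite andbF.
Qed.

(** If [K] meets the square, [F] does not, and crossings are changes of [G], even in number around
    the square; otherwise there are none. *)
Let crossing_square i j : (i < n)%N -> (j < m)%N ->
  crossing i j i.+1 j (+) crossing i j.+1 i.+1 j.+1 =
  crossing i j i j.+1 (+) crossing i.+1 j i.+1 j.+1.
Proof.
move=> iln jm; have [iln' jm'] := (ltnW iln, ltnW jm).
have noF v w : v \in [:: i; i.+1] -> w \in [:: j; j.+1] -> K v w ->
    [/\ ~~ F i j, ~~ F i.+1 j, ~~ F i j.+1 & ~~ F i.+1 j.+1].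
  rewrite !inE => /orP[]/eqP-> /orP[]/eqP-> KV;
  by split; apply: (K_F _ _ _ _ KV); rewrite ?leqnn ?leqnSn// !leqW.
have [Ks|] := boolP [|| K i j, K i.+1 j, K i j.+1 | K i.+1 j.+1].
  have [F1 F2 F3 F4] : [/\ ~~ F i j, ~~ F i.+1 j, ~~ F i j.+1 & ~~ F i.+1 j.+1].
    case/or4P: Ks; apply: noF; rewrite !inE ?eqxx ?orbT//.
  have c00 := cover iln' jm'; have c10 := cover iln jm'.
  have c01 := cover iln' jm; have c11 := cover iln jm.
  rewrite (crossing_noF c00 c10 F1 F2 (G_horizontal iln jm')).
  rewrite (crossing_noF c01 c11 F3 F4 (G_horizontal iln jm)).
  rewrite (crossing_noF c00 c01 F1 F3 (G_vertical iln' jm)).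
  rewrite (crossing_noF c10 c11 F2 F4 (G_vertical iln jm)).
  by case: (G i j); case: (G i.+1 j); case: (G i j.+1); case: (G i.+1 j.+1).
by rewrite !negb_or => /and4P[? ? ? ?]; rewrite !crossing_noK.
Qed.

Let row j k := \big[addb/false]_(0 <= i < k) crossing i j i.+1 j.

Let row_succ j k : (j < m)%N -> (k <= n)%N ->
  row j k (+) row j.+1 k = crossing 0 j 0 j.+1 (+) crossing k j k j.+1.
Proof.
move=> jm; elim: k => [_|k IHk kn]; first by rewrite /row !big_geq // !addbb.
have sq := crossing_square kn jm; move: (IHk (ltnW kn)).
rewrite /row !big_nat_recr//=; move: sq.
case: (crossing k j k.+1 j); case: (crossing k j.+1 k.+1 j.+1);
case: (crossing k j k j.+1); case: (crossing k.+1 j k.+1 j.+1);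
case: (crossing 0 j 0 j.+1); case: (\big[addb/false]_(_ <= _ < _) _);
by case: (\big[addb/false]_(_ <= _ < _) _).
Qed.

Let row_const j : (j <= m)%N -> row j n = row m n.
Proof.
move=> jm; rewrite -(subKn jm); elim: (m - j)%N (leq_subr j m) => [|k IHk] km.
  by rewrite subn0.
rewrite -(IHk (ltnW km)).
have mk : ((m - k.+1).+1 = m - k)%N by rewrite subnS prednK// subn_gt0.
have mkm : (m - k.+1 < m)%N by rewrite mk leq_subr.
have := row_succ mkm (leqnn n); rewrite mk.
rewrite !crossing_noK ?K_left ?K_right ?leq_subr//.
by case: (row _ n); case: (row _ n).
Qed.

(** The bottom row avoids [F], so its parity telescopes to the change of [G] between its ends; the
    top row avoids [K], so its parity is 0. *)
Lemma grid_connected : G 0%N 0%N = G n 0%N.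
Proof.
have row0 k : (k <= n)%N -> row 0 k = G 0%N 0%N (+) G k 0%N.
  elim: k => [_|k IHk kn]; first by rewrite /row big_geq // addbb.
  rewrite /row big_nat_recr//= -/(row 0 k) IHk; last exact: ltnW.
  rewrite crossing_noF ?F_bottom ?cover ?(ltnW kn)//; last first.
    by move=> *; apply: G_horizontal.
  by case: (G 0%N 0%N); case: (G k 0%N); case: (G k.+1 0%N).
have : row 0 n = false.
  rewrite row_const// /row big_nat big1// => i /andP[_ iln].
  by rewrite crossing_noK ?K_top// ltnW.
by rewrite row0//; case: (G 0%N 0%N); case: (G n 0%N).
Qed.

End Grid.

(** * Quasi-components of compact sets *)

Section QuasiComponent.
Variables (T : topologicalType) (K : set T) (a : T).
Hypotheses (cK : compact K) (closedK : closed K) (Ka : K a).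

Definition clopen_part D :=
  [/\ D `<=` K, D a, closed D & closed (K `\` D)].

Definition quasi_component : set T := [set p | forall D, clopen_part D -> D p].

Lemma clopen_partT : clopen_part K.
Proof. by split=> //; rewrite setDv; exact: closed0. Qed.

Lemma clopen_partI D D' : clopen_part D -> clopen_part D' ->
  clopen_part (D `&` D').
Proof.
move=> [DK Da cD cKD] [_ Da' cD' cKD']; split=> //.
- by move=> p [/DK].
- exact: closedI.
- by rewrite setDIr; exact: closedU.
Qed.

(** Otherwise the traces of the clopen parts on [C] generate a proper filter, and a cluster point of
    it lies in the quasi-component and in [C]. *)
Lemma quasi_component_separated C : closed C ->
  quasi_component `&` C = set0 -> exists2 D, clopen_part D & D `&` C = set0.
Proof.
move=> cC QC; apply: contrapT => noD.
pose G := filter_from clopen_part (fun D => D `&` C).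
have PG : ProperFilter G.
  apply: filter_from_proper.
    apply: filter_from_filter; first by exists K; exact: clopen_partT.
    move=> D D' pD pD'; exists (D `&` D'); first exact: clopen_partI.
    by move=> p [[]].
  by move=> D pD; apply/set0P/eqP => DC; apply: noD; exists D.
have GK : G K by exists K; [exact: clopen_partT|move=> p []].
have [p [Kp clp]] := cK PG GK.
suff : (quasi_component `&` C) p by rewrite QC.
have pDC D : clopen_part D -> (D `&` C) p.
  move=> pD; have cDC : closed (D `&` C) by apply: closedI => //; case: pD.
  by apply: cDC => U Up; apply: clp => //; exists D.
by split=> [D /pDC[]//|]; have [] := pDC K clopen_partT.
Qed.

Lemma closed_quasi_component : closed quasi_component.
Proof.
rewrite (_ : quasi_component = \bigcap_(D in clopen_part) D).
  by apply: closed_bigI => D [].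
by apply/seteqP; split=> p.
Qed.

(** If disjoint closed [Q1] and [Q2] cover the quasi-component, some clopen part lies in the union
    of disjoint open sets around them. Removing the one around [Q2] leaves a clopen part through
    [a], so the piece without [a] is empty. *)
Lemma quasi_component_connected (R : realType) :
  normal_space T -> connected quasi_component.
Proof.
move=> nT.
have Qa : quasi_component a by move=> D [].
have part Q1 Q2 : closed Q1 -> closed Q2 -> Q1 `&` Q2 = set0 ->
    quasi_component `<=` Q1 `|` Q2 -> Q1 a -> quasi_component `&` Q2 = set0.
  move=> c1 c2 Q12 QQ Q1a.
  have [U1 [U2 [opU1 opU2 QU1 QU2 U12]]] := (@normal_openP R T).1 nT _ _ c1 c2 Q12.
  have [||D [DK Da cD cKD] DU] := @quasi_component_separated (~` U1 `&` ~` U2).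
  - by apply: closedI; exact: open_closedC.
  - apply/seteqP; split=> // p [/QQ[/QU1|/QU2] ? []] //.
  have DE : D `&` U2 = D `&` ~` U1.
    apply/seteqP; split=> p [Dp Up]; split=> //.
      by move=> U1p; suff : (U1 `&` U2) p by rewrite U12.
    apply: contrapT => U2p.
    by suff : (D `&` (~` U1 `&` ~` U2)) p by rewrite DU.
  have pD : clopen_part (D `&` ~` U2).
    split.
    - by move=> p [/DK].
    - split=> // U2a; suff : (U1 `&` U2) a by rewrite U12.
      by split=> //; exact: QU1.
    - by apply: closedI => //; exact: open_closedC.
    - rewrite (_ : K `\` _ = K `\` D `|` D `&` ~` U1).
        by apply: closedU => //; apply: closedI => //; exact: open_closedC.
      rewrite -DE setDIr; apply/seteqP; split=> p.
        move=> [|[Kp U2p]]; first by left.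
        by have [Dp|nDp] := pselect (D p); [right; split=> //; apply: contrapT|left].
      by move=> [|[Dp U2p]]; [left|right; split; [exact: DK|]].
  apply/seteqP; split=> // p [Qp /QU2 U2p].
  by have [_ /(_ U2p)] := Qp _ pD.
move=> B [b Bb] [U openU BU] [C cC BC].
have QB : B `<=` quasi_component by rewrite BU => p [].
have cB : closed B by rewrite BC; exact: closedI closed_quasi_component cC.
have cB' : closed (quasi_component `&` ~` U).
  by apply: closedI; [exact: closed_quasi_component|exact: open_closedC].
have BB' : B `&` (quasi_component `&` ~` U) = set0.
  by apply/seteqP; split=> // p []; rewrite BU => -[Qp Op] [_ /(_ Op)].
have QE : quasi_component `<=` B `|` (quasi_component `&` ~` U).
  move=> p Qp; have [Op|nOp] := pselect (U p); first by left; rewrite BU.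
  by right.
apply/seteqP; split=> // p Qp; have [Ba|nBa] := pselect (B a).
  have E0 := part _ _ cB cB' BB' QE Ba.
  case: (QE _ Qp) => // Q2; suff : (quasi_component `&` (quasi_component `&` ~` U)) p.
    by rewrite E0.
  by split.
have := part _ _ cB' cB; rewrite setIC => /(_ BB'); rewrite setUC => /(_ QE).
case: (QE _ Qa) => // Q2 /(_ Q2) E0.
suff : (quasi_component `&` B) b by rewrite E0.
by split=> //; exact: QB.
Qed.

End QuasiComponent.
Lemma compact_closed_dist (R : realType) (V : normedModType R) (K F : set V) :
  compact K -> closed F -> K `&` F = set0 ->
  exists2 d : R, 0 < d & forall p q, K p -> F q -> d <= `|p - q|.
Proof.
move=> /compact_near_coveringP cK cF KF.
have near_K : \forall d \near (0 : R)^'+, K `<=` (fun p => forall q, F q -> d <= `|p - q|).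
  apply: cK => p Kp.
  have [e e0 eF] : exists2 e : R, 0 < e & ball p e `<=` ~` F.
    apply/nbhs_ballP; apply: open_nbhs_nbhs; split; first exact: closed_openC.
    by move=> Fp; suff : (K `&` F) p by rewrite KF.
  near=> p' d; move=> q Fq.
  have pp' : `|p - p'| < e / 2.
    by near: p'; apply: cvgr_dist_lt; rewrite ?divr_gt0//; exact: cvg_id.
  have de : d < e / 2 by near: d; apply: nbhs_right_lt; rewrite divr_gt0.
  have pq : e <= `|p - q|.
    by rewrite leNgt; apply/negP => pq; apply: (eF q) => //; rewrite -ball_normE.
  apply: (@le_trans _ _ (e - e / 2)); first by rewrite {1}(splitr e) addrK ltW.
  rewrite lerBlDl (le_trans pq)// (le_trans (ler_distD p' p q))//.
  by rewrite lerD2r ltW.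
near (0 : R)^'+ => d.
exists d; first by near: d; exact: nbhs_right_gt.
move=> p q Kp Fq.
suff H : K `<=` (fun p => forall q, F q -> d <= `|p - q|) by exact: H.
by near: d.
Unshelve. all: by end_near. Qed.

(** * Enclosing the part of [E] on the axis *)

Section Enclosure.
Variables (R : realType) (E : set (R * R)).
Hypothesis closedE : closed E.
Let axis : set (R * R) := `[-1, 1] `*` [set 0].

Definition enclosing (D : set (R * R)) :=
  [/\ D `<=` E, closed D, closed (E `\` D) &
      exists M : R, forall p, D p -> -1 < p.1 < 1 /\ `|p.2| <= M].

Lemma enclosing0 : enclosing set0.
Proof.
split=> //; first exact: closed0; first by rewrite setD0.
by exists 0.
Qed.

Lemma enclosingU D D' : enclosing D -> enclosing D' -> enclosing (D `|` D').
Proof.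
move=> [DE cD cED [M DM]] [DE' cD' cED' [M' DM']]; split.
- by move=> p [/DE|/DE'].
- exact: closedU.
- by rewrite setDUr; exact: closedI.
- exists (Num.max M M') => p [/DM|/DM'] [p1 p2]; split=> //.
    by rewrite le_max p2.
  by rewrite le_max p2 orbT.
Qed.

Lemma axis_compact : compact axis.
Proof.
by apply: compact_setX; [exact: segment_compact|exact: compact_set1].
Qed.

(** The component of [a] gives a height bound. In a taller box the quasi-component of [a] is
    connected, hence misses both sides and stays within that bound; some clopen part then misses
    [outside] as well. *)
Lemma enclosing_point a :
  (forall C, C `<=` E -> connected C -> C a ->
    bounded_set C /\ C `&` ([set -1; 1] `*` [set: R]) = set0) ->
  E a -> axis a -> exists2 D, enclosing D & D a.
Proof.
move=> bounded_away Ea [a1 a2].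
have [[M [Mreal HM]] _] := bounded_away _ (@connected_component_sub _ E a)
  (@component_connected _ E a) (connected_component_refl Ea).
pose N := `|M| + 1.
have N0 : 0 < N by rewrite ltr_pwDr.
have comp_lt p : connected_component E a p -> `|p.2| < N + 1.
  move=> Cp; have MN : M < N by rewrite /N (le_lt_trans (ler_norm M))// ltrDl.
  have := HM _ MN _ Cp; rewrite /= prod_normE ge_max => /andP[_]; rewrite /N; lra.
pose box : set (R * R) := `[-1, 1] `*` `[- (N + 1), N + 1].
have cbox : compact box by apply: compact_setX; exact: segment_compact.
have closed_box : closed box.
  by apply: compact_closed => //; exact: norm_hausdorff.
pose K := E `&` box.
have cK : compact K by rewrite /K setIC; exact: compact_closedI.
have closedK : closed K by exact: closedI.
have Ka : K a.
  split=> //; split=> //=; rewrite a2 in_itv /=; apply/andP; split; lra.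
have cf1 := @continuous_fst R R; have cf2 := @continuous_snd R R.
pose outside : set (R * R) := (fst @^-1` [set x | x <= -1]) `|`
  (fst @^-1` [set x | 1 <= x]) `|`
  ((fun p : R * R => `|p.2|) @^-1` [set x | N + 1 <= x]).
have c_out : closed outside.
  apply: closedU; first apply: closedU.
  - by apply: preimage_closed => //; exact: closed_le.
  - by apply: preimage_closed => //; exact: closed_ge.
  - apply: (@preimage_closed _ _ (fun p : R * R => `|p.2|)); last exact: closed_ge.
    by move=> p _; exact: (continuous_comp1 (@norm_continuous _ R) cf2).
have cQ : connected (quasi_component K a).
  exact: (quasi_component_connected cK closedK Ka R (@pseudometric_normal R _)).
have QK : quasi_component K a `<=` K.
  by move=> p; apply; exact: (clopen_partT closedK Ka).
have QE : quasi_component K a `<=` E by move=> p /QK [].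
have Qa : quasi_component K a a by move=> D [].
have [_ Qside] := bounded_away _ QE cQ Qa.
have Qout : quasi_component K a `&` outside = set0.
  apply/seteqP; split=> // p [Qp out].
  have [_ [/= p1 p2]] := QK _ Qp.
  have side : p.1 = -1 \/ p.1 = 1 -> False.
    move=> p11; suff : (quasi_component K a `&` ([set -1; 1] `*` [set: R])) p.
      by rewrite Qside.
    by split.
  move: p1; rewrite in_itv /= => /andP[p1 p1'].
  case: out => [[/= h|/= h]|/= h].
  - by apply: side; left; apply/eqP; rewrite eq_le h.
  - by apply: side; right; apply/eqP; rewrite eq_le h andbT.
  - have := comp_lt p (connected_component_max Qa QE cQ Qp).
    by rewrite ltNge h.
have [D [DK Da cD cKD] Dout] := quasi_component_separated cK closedK Ka c_out Qout.
have Din p : D p -> [/\ -1 < p.1, p.1 < 1 & `|p.2| < N + 1].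
  move=> Dp; have nout : ~ outside p.
    by move=> op; suff : (D `&` outside) p by rewrite Dout.
  by split; rewrite ltNge; apply/negP => h; apply: nout;
    [left; left|left; right|right].
exists D => //; split=> //.
- by move=> p /DK [].
(* Points of [E] not in [outside] lie in the box, and those in [outside] are not in [D]. *)
- rewrite (_ : E `\` D = (K `\` D) `|` (E `&` outside)).
    by apply: closedU => //; exact: closedI.
  apply/seteqP; split=> p.
    move=> [Ep nDp]; have [op|nop] := pselect (outside p); first by right.
    left; split=> //; split=> //; split; rewrite /= in_itv /=; apply/andP; split.
    + by rewrite ltW// ltNge; apply/negP => h; apply: nop; left; left.
    + by rewrite ltW// ltNge; apply/negP => h; apply: nop; left; right.
    + have : `|p.2| < N + 1 by rewrite ltNge; apply/negP => h; apply: nop; right.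
      by rewrite ltr_norml; lra.
    + have : `|p.2| < N + 1 by rewrite ltNge; apply/negP => h; apply: nop; right.
      by rewrite ltr_norml; lra.
  move=> [[[Ep _] nDp]//|[Ep op]]; split=> // Dp.
  by suff : (D `&` outside) p by rewrite Dout.
- by exists (N + 1) => p /Din [? ? /ltW]; split=> //; apply/andP.
Qed.

(** A compactness argument: enclosing sets are stable under union, and the filter [G] of large
    enclosing sets replaces the choice of a finite cover. *)
Lemma enclosing_axis :
  (forall C, C `<=` E -> connected C -> C `&` axis !=set0 ->
    bounded_set C /\ C `&` ([set -1; 1] `*` [set: R]) = set0) ->
  exists2 D, enclosing D & E `&` axis `<=` D.
Proof.
move=> bounded_away; pose A := E `&` axis.
have cA : compact A by rewrite /A setIC; apply: compact_closedI => //; exact: axis_compact.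
pose G := filter_from enclosing (fun D => [set D' | enclosing D' /\ D `<=` D']).
have FG : Filter G.
  apply: filter_from_filter; first by exists set0; exact: enclosing0.
  move=> D D' eD eD'; exists (D `|` D'); first exact: enclosingU.
  by move=> D'' [eD'' sub]; split; split=> // p Dp; apply: sub; [left|right].
have [a [Ea axa]|D0 eD0 D0P] :=
    (compact_near_coveringP A).1 cA _ G (fun D p => E p -> D p) FG.
  have [|D eD Da] := @enclosing_point a _ Ea axa.
    by move=> C CE cC Ca; apply: bounded_away => //; exists a.
  exists (~` (E `\` D), [set D' | enclosing D' /\ D `<=` D']).
    split; last by exists D.
    apply: open_nbhs_nbhs; split; last by case.
    by apply: closed_openC; case: eD.
  move=> [p D'] /= [nED [_ DD']] Ep; apply: DD'.
  by apply: contrapT => nDp; apply: nED.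
exists D0 => // p [Ep axp].
by apply: (D0P D0) => //; split.
Qed.

End Enclosure.
(** * Transport of a pair of sublevel sets *)

Section Chain.
Variables (R : realType) (X : completeNormedModType R).
Variables (g : nat -> X -> R) (n m : nat) (y : nat -> R) (N : nat -> nat -> bool).
Variables (r k : R).
Hypotheses (r_gt0 : 0 < r) (k_ge0 : 0 <= k) (k_r : 2 * k <= r).
Hypothesis cg : forall i, continuous (g i).
Hypothesis N_pushable : forall i j, (i <= n)%N -> (j <= m)%N -> N i j ->
  pushable (g i) (y j) r.
Hypothesis g_interleaved : forall i j, (i < n)%N -> (j <= m)%N ->
  interleaved (g i) (g i.+1) k (y j) /\
  interleaved (g i) (g i.+1) k (y j + k).
Hypothesis y_step : forall j,
  y j <= y j.+1 <= y j + r \/ y j.+1 <= y j <= y j.+1 + r.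

(* [level_chain i j] is all that is kept of a path from [(0, 0)] to [(i, j)]:
   one step for each slice, and jumps between equivalent levels. *)
Fixpoint level_chain (i j : nat) : Prop :=
  match i with
  | 0 => equilevel (g 0%N) (y 0%N) (y j)
  | i'.+1 => exists u,
      [/\ (u <= m)%N, N i' u, N i u, level_chain i' u & equilevel (g i) (y u) (y j)]
  end.

Lemma interleaved_sym (g1 g2 : X -> R) (c : R) :
  interleaved g1 g2 k c -> interleaved g2 g1 k c.
Proof. by move=> I x; have [? ?] := I x. Qed.

Lemma chain_equilevel i j j' : (i <= n)%N -> (j <= m)%N -> (j' <= m)%N ->
  N 0%N 0%N -> N i j -> N i j' -> level_chain i j -> equilevel (g i) (y j) (y j') ->
  level_chain i j'.
Proof.
move=> iln jm j'm N00 Nj Nj'; case: i iln Nj Nj' => [|i] iln Nj Nj' /=.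
  move=> c e.
  by apply: (equilevel_trans (@cg 0%N) r_gt0 _ _ _ c e); exact: N_pushable.
move=> [u [um Nu Nu' c e']] e; exists u; split=> //.
by apply: (equilevel_trans (@cg i.+1) r_gt0 _ _ _ e' e); exact: N_pushable.
Qed.

Lemma chain_vertical i j : (i <= n)%N -> (j < m)%N -> N 0%N 0%N ->
  N i j -> N i j.+1 -> (level_chain i j <-> level_chain i j.+1).
Proof.
move=> iln jm N00 Nj Nj'.
have e : equilevel (g i) (y j) (y j.+1).
  case: (y_step j) => ?.
    by apply: (pushable_equilevel (N_pushable iln (ltnW jm) Nj)) => //; exact: ltW.
  apply: equilevel_sym.
  by apply: (pushable_equilevel (N_pushable iln jm Nj')) => //; exact: ltW.
split=> c; first exact: (chain_equilevel iln (ltnW jm) jm N00 Nj Nj' c e).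
exact: (chain_equilevel iln jm (ltnW jm) N00 Nj' Nj c (equilevel_sym e)).
Qed.

(** Going back to slice [i] undoes an excursion: the jump made on slice [i.+1] is transported to
    slice [i], where it prolongs the shorter chain. *)
Lemma chain_horizontal i j : (i < n)%N -> (j <= m)%N -> N 0%N 0%N ->
  N i j -> N i.+1 j -> (level_chain i j <-> level_chain i.+1 j).
Proof.
move=> iln jm N00 Nj Nj'; split=> [c|[u [um Nu Nu' c e]]].
  by exists j; split=> //; exact: equilevel_refl.
apply: (chain_equilevel (ltnW iln) um jm N00 Nu Nj c).
have [i1 i2] := g_interleaved iln um; have [i3 i4] := g_interleaved iln jm.
apply: (interleaved_equilevel (@cg i) r_gt0 k_ge0 k_r _ _ _ _ _ _ _ _ e);
  by [apply: N_pushable => //; exact: ltnW|exact: interleaved_sym].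
Qed.

End Chain.

Section TwoChains.
Variables (R : realType) (X : completeNormedModType R).
Variables (g : nat -> X -> R) (n m : nat) (y z : nat -> R).
Variables (N N' : nat -> nat -> bool) (r k : R).
Hypotheses (r_gt0 : 0 < r) (k_ge0 : 0 <= k) (k_r : 2 * k <= r).
Hypothesis N_pushable : forall i j, (i <= n)%N -> (j <= m)%N -> N i j ->
  pushable (g i) (y j) r.
Hypothesis N'_pushable : forall i j, (i <= n)%N -> (j <= m)%N -> N' i j ->
  pushable (g i) (z j) r.
Hypothesis y_interleaved : forall i j, (i < n)%N -> (j <= m)%N ->
  interleaved (g i) (g i.+1) k (y j) /\
  interleaved (g i) (g i.+1) k (y j + k).
Hypothesis z_interleaved : forall i j, (i < n)%N -> (j <= m)%N ->
  interleaved (g i) (g i.+1) k (z j) /\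
  interleaved (g i) (g i.+1) k (z j + k).
Hypothesis zy : forall j j', z j <= y j'.

(** Each new slice costs one step of the whole pair, then a jump of its upper level and a jump of
    its lower level. *)
Lemma chains_pair_equiv i j j' : (i <= n)%N -> (j <= m)%N -> (j' <= m)%N ->
  level_chain g m y N i j -> level_chain g m z N' i j' ->
  pair_equiv (level_pair (g 0%N) (y 0%N) (z 0%N)) (level_pair (g i) (y j) (z j')).
Proof.
elim: i j j' => [|i IHi] j j' iln jm j'm /=.
  move=> ey ez; apply: pair_equiv_trans (equilevel_pair_equiv_bottom _ _ ez) => //.
  exact: equilevel_pair_equiv_top.
move=> [u [um Nu Nu' cu ey]] [v [vm Nv Nv' cv ez]].
apply: pair_equiv_trans (equilevel_pair_equiv_bottom _ _ ez) => //.
apply: pair_equiv_trans (equilevel_pair_equiv_top _ _ ey) => //.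
apply: pair_equiv_trans (IHi u v (ltnW iln) um vm cu cv) _.
have [i1 i2] := y_interleaved iln um; have [i3 i4] := z_interleaved iln vm.
by apply: (interleaved_pair_equiv k_ge0 k_r) => //;
  [apply: N_pushable => //; exact: ltnW|apply: N'_pushable => //; exact: ltnW
  |exact: N_pushable|exact: N'_pushable].
Qed.

End TwoChains.

Lemma slice_pushable (R : realType) (X : completeNormedModType R)
    (f : R * X -> R) (l y rho : R) :
  C1 f -> PS f -> -1 <= l <= 1 -> 0 < rho ->
  (forall z, y - rho <= z <= y + rho -> ~ critical_pairs f (l, z)) ->
  pushable (slice f l) y (rho / 2).
Proof.
move=> fC1 fPS l1 rho0 noncrit; apply: (regular_pushable (@differentiable_slice _ _ _ fC1 l)
  (@slice_near _ _ _ fC1 l)) => //.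
- move=> c x gx dx; apply: (fPS 1%N c I (fun=> l) x) => //.
- by move=> x gx crit; apply: (noncrit _ gx); exists x.
Qed.

(** * A grid of parameters and levels *)

Section RegularChain.
Variables (R : realType) (X : completeNormedModType R) (f : R * X -> R).
Variables (K F : set (R * R)) (d B e L Mp Nb : R) (n m : nat).
Hypotheses (fC1 : C1 f) (fPS : PS f).
Hypothesis partial_le : forall p : R * X,
  -1 <= p.1 <= 1 -> - Nb <= f p <= Nb -> `|partial1 f p| <= Mp.
Hypothesis K_F_dist : forall p q, K p -> F q -> d <= `|p - q|.
Hypothesis critical_KF : forall l z, -1 <= l <= 1 ->
  critical_pairs f (l, z) -> K (l, z) \/ F (l, z).
Hypothesis axis_K : forall l, -1 <= l <= 1 -> K (l, 0).
Hypothesis K_side : forall p, K p -> p.1 = -1 \/ p.1 = 1 -> p.2 = 0.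
Hypothesis K_le : forall p, K p -> `|p.2| <= B.
Hypotheses (e_gt0 : 0 < e) (e_d : e <= d / 4) (MpL : Mp < L) (L_ge0 : 0 <= L).
(** Critical levels are farther than [e / 2] from a neutral vertex on its slice, and half of this is
    the available push; [r] is also the spacing of the rows. The drift across one column is [k]. *)
Let r := e / 2 / 2.
Let k := L * (2 / n%:R).
Hypotheses (n_gt0 : (0 < n)%N) (n_d : 2 / n%:R < d) (k_r : 2 * k <= r).
Hypotheses (m_B : B < m%:R * r) (m_Nb : e + m%:R * r + 2 * k <= Nb).

Let lambda (i : nat) : R := -1 + i%:R * (2 / n%:R).
Let g i : X -> R := slice f (lambda i).
(** The sign [s] selects the half-strip; the rows move away from the axis, starting at distance
    [e]. *)
Let y (s : R) (j : nat) : R := s * (e + j%:R * r).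

Let r_gt0 : 0 < r. Proof. by rewrite /r !divr_gt0. Qed.

Let n_gt0R : 0 < n%:R :> R. Proof. by rewrite ltr0n. Qed.

Let step_gt0 : 0 < 2 / n%:R :> R. Proof. by rewrite divr_gt0. Qed.

Let k_ge0 : 0 <= k. Proof. by rewrite mulr_ge0// ltW. Qed.

Let lambda0 : lambda 0%N = -1. Proof. by rewrite /lambda mul0r addr0. Qed.

Let lambdan : lambda n = 1.
Proof. by rewrite /lambda mulrCA divff ?gt_eqF// mulr1; lra. Qed.

Let lambda_itv i : (i <= n)%N -> -1 <= lambda i <= 1.
Proof.
move=> iln; apply/andP; split.
  by rewrite /lambda lerDl mulr_ge0// ltW.
by rewrite -lambdan /lambda lerD2l ler_pM2r// ler_nat.
Qed.

Let natr_dist i i' : (i <= i'.+1)%N -> (i' <= i.+1)%N -> `|i%:R - i'%:R| <= 1 :> R.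
Proof.
rewrite -(ler_nat R) -natr1 => h; rewrite -(ler_nat R) -natr1 => h'.
rewrite ler_norml; lra.
Qed.

Let lambda_dist i i' : (i <= i'.+1)%N -> (i' <= i.+1)%N ->
  `|lambda i - lambda i'| <= 2 / n%:R.
Proof.
move=> h h'; rewrite /lambda opprD addrACA subrr add0r -mulrBl normrM.
by rewrite (gtr0_norm step_gt0) ler_piMl ?(ltW step_gt0)// natr_dist.
Qed.

Section Sign.
Variable s : R.
Hypothesis s1 : `|s| = 1.

Let y_dist j j' : (j <= j'.+1)%N -> (j' <= j.+1)%N -> `|y s j - y s j'| <= r.
Proof.
move=> h h'; rewrite /y -mulrBr opprD addrACA subrr add0r -mulrBl normrM s1 mul1r normrM.
by rewrite (gtr0_norm r_gt0) ler_piMl ?(ltW r_gt0)// natr_dist.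
Qed.

Let y_norm j : `|y s j| = e + j%:R * r.
Proof.
rewrite /y normrM s1 mul1r ger0_norm// addr_ge0// ?(ltW e_gt0)//.
by rewrite mulr_ge0// ltW.
Qed.

Let y_ge j : e <= `|y s j|.
Proof. by rewrite y_norm lerDl mulr_ge0// ltW. Qed.

Let y_le j : (j <= m)%N -> `|y s j| + 2 * k <= Nb.
Proof.
move=> jm; rewrite y_norm (le_trans _ m_Nb)// lerD2r lerD2l ler_wpM2r ?ler_nat//.
exact: ltW.
Qed.

(** Only points on the slice itself count, as pushing down concerns one slice. *)
Definition near_vertex (S : set (R * R)) i j :=
  exists p, [/\ S p, p.1 = lambda i & `|p.2 - y s j| <= e / 2].

Definition neutral i j :=
  ~~ `[< near_vertex K i j >] && ~~ `[< near_vertex F i j >].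

Lemma neutral_pushable i j : (i <= n)%N -> neutral i j -> pushable (g i) (y s j) r.
Proof.
move=> iln /andP[/asboolPn nK /asboolPn nF].
apply: slice_pushable => //; first exact: lambda_itv.
  by rewrite divr_gt0.
move=> z zy crit.
have zy' : `|z - y s j| <= e / 2 by rewrite ler_norml; lra.
have [Kz|Fz] := critical_KF (lambda_itv iln) crit.
  by apply: nK; exists (lambda i, z).
by apply: nF; exists (lambda i, z).
Qed.

Lemma slices_interleaved i j : (i < n)%N -> (j <= m)%N ->
  interleaved (g i) (g i.+1) k (y s j) /\
  interleaved (g i) (g i.+1) k (y s j + k).
Proof.
move=> iln jm.
have key z : - Nb <= z -> z + k <= Nb -> interleaved (g i) (g i.+1) k z.
  have lE : `|lambda i - lambda i.+1| = 2 / n%:R.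
    rewrite /lambda opprD addrACA subrr add0r -mulrBl -[i.+1%:R]natr1 opprD addrA.
    by rewrite subrr sub0r mulN1r normrN gtr0_norm.
  have l1 := lambda_itv (ltnW iln); have l2 := lambda_itv iln.
  move=> z1 z2 x; split=> gx.
    have := sublevel_drift fC1 partial_le MpL L_ge0 l1 l2 z1 _ gx.
    by rewrite lE; apply.
  have := sublevel_drift fC1 partial_le MpL L_ge0 l2 l1 z1 _ gx.
  by rewrite distrC lE; apply.
have := y_le jm; have := ler_norm (y s j); have := ler_norm (- y s j).
rewrite normrN => h1 h2 h3; have := k_ge0.
by split; apply: key; lra.
Qed.

(** The grid argument applies to the neutral vertices reached by a chain: [K] meets the two sides on
    the axis only, the axis keeps [F] off the bottom row, and the top row is above [K]. *)
Lemma regular_chain : level_chain g m (y s) neutral n 0%N.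
Proof.
have noK_side i j : i = 0%N \/ i = n -> ~~ `[< near_vertex K i j >].
  move=> i0n; apply/asboolPn => -[p [Kp p1 p2]].
  have p20 : p.2 = 0.
    by apply: (K_side Kp); rewrite p1; case: i0n => ->; [left|right].
  by move: p2; rewrite p20 sub0r normrN; have := y_ge j; have := e_gt0; lra.
have noF_bottom i : (i <= n)%N -> ~~ `[< near_vertex F i 0%N >].
  move=> iln; apply/asboolPn => -[p [Fp p1 p2]].
  have := K_F_dist (axis_K (lambda_itv iln)) Fp.
  rewrite prod_normE /= p1 subrr normr0 sub0r normrN max_r//.
  have := ler_normD (p.2 - y s 0%N) (y s 0%N); rewrite subrK y_norm mul0r addr0.
  by move: p2; have := e_d; have := e_gt0; lra.
have N00 : neutral 0%N 0%N by rewrite /neutral noK_side ?noF_bottom//; left.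
have cg i : continuous (g i).
  by move=> x; apply: differentiable_continuous; exact: differentiable_slice.
have push i j : (i <= n)%N -> (j <= m)%N -> neutral i j -> pushable (g i) (y s j) r.
  by move=> iln _; exact: neutral_pushable.
have ystep j : y s j <= y s j.+1 <= y s j + r \/ y s j.+1 <= y s j <= y s j.+1 + r.
  have : `|y s j - y s j.+1| <= r by apply: y_dist; rewrite ?leqnn// !leqW.
  rewrite ler_norml => yr; have [|] := leP (y s j) (y s j.+1) => ?; [left|right]; lra.
pose G i j := neutral i j && `[< level_chain g m (y s) neutral i j >].
suff : G n 0%N by move=> /andP[_ /asboolP].
rewrite -(@grid_connected n m neutral (fun i j => `[< near_vertex K i j >])
  (fun i j => `[< near_vertex F i j >]) G).
- by rewrite /G N00; apply/asboolP; exact: equilevel_refl.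
- by move=> i j _ _; rewrite /neutral; case: asboolP => //; case: asboolP.
- by move=> i j /andP[].
- by move=> i j /andP[].
(* Horizontally the points are closer than [d] by the mesh; vertically the distance is at most
   [e / 2 + r + e / 2], that is [5 * e / 4], below [d]. *)
- move=> i j i' j' ii' i'i jj' j'j /asboolP[p [Kp p1 p2]].
  apply/asboolPn => -[q [Fq q1 q2]].
  have := K_F_dist Kp Fq; apply/negP; rewrite -ltNge prod_normE gt_max /=.
  rewrite p1 q1 (le_lt_trans (lambda_dist ii' i'i))//=.
  have := y_dist jj' j'j; have := e_d; move: p2 q2; rewrite /r !ler_norml ltr_norml.
  by have := e_gt0; lra.
- move=> i j iln jm Nij Nij'; rewrite /G Nij Nij' /=; apply/asbool_equiv_eq.
  exact: (chain_horizontal r_gt0 k_ge0 k_r cg push slices_interleaved).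
- move=> i j iln jm Nij Nij'; rewrite /G Nij Nij' /=; apply/asbool_equiv_eq.
  exact: (chain_vertical r_gt0 cg push ystep).
- by move=> j _; apply: noK_side; left.
- by move=> j _; apply: noK_side; right.
- move=> i iln; apply/asboolPn => -[p [Kp p1 p2]].
  have := K_le Kp; have := ler_distD p.2 (y s m) 0; rewrite !subr0 y_norm distrC.
  by move: p2; have := e_gt0; have := m_B; lra.
- exact: noF_bottom.
Qed.

End Sign.

Lemma end_slices_equiv :
  pair_equiv (level_pair (slice f (-1)) e (- e)) (level_pair (slice f 1) e (- e)).
Proof.
have s1 : `|1 : R| = 1 by rewrite normr1.
have sN1 : `|-1 : R| = 1 by rewrite normrN1.
have c := regular_chain s1; have c' := regular_chain sN1.
have yz j j' : y (-1) j <= y 1 j'.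
  rewrite /y mulN1r mul1r; have p i : 0 <= i%:R * r by rewrite mulr_ge0// ltW.
  by have := p j; have := p j'; have := e_gt0; lra.
have push s (s1' : `|s| = 1) i j : (i <= n)%N -> (j <= m)%N -> neutral s i j ->
    pushable (g i) (y s j) r.
  by move=> iln _; exact: neutral_pushable.
have := chains_pair_equiv k_ge0 k_r (push 1 s1) (push (-1) sN1)
  (slices_interleaved s1) (slices_interleaved sN1) yz
  (leqnn n) (leq0n m) (leq0n m) c c'.
by rewrite /g lambda0 lambdan /y mul0r addr0 mulN1r mul1r.
Qed.

End RegularChain.

(** * Choice of the constants and conclusion *)

Theorem theorem3p2 (R : realType) (X : completeNormedModType R)
    (f : R * X -> R)
    (f_C1 : C1 f)
    (f_triv : forall l : R, f (l, 0) = 0)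
    (crit_triv : forall l : R, critical f l 0)
    (f_PS : PS f)
    (partial1_bounded : forall N : nat,
      [bounded partial1 f p | p in
        [set p : R * X | p.1 \in `[- N%:R, N%:R] /\ f p \in `[- N%:R, N%:R]]])
    (nobif_m1 : ~ bifurcation_point f (-1, 0))
    (nobif_1 : ~ bifurcation_point f (1, 0))
    (not_equiv : exists2 eps_star : R, 0 < eps_star &
      forall eps : R, 0 < eps < eps_star ->
        ~ sublevel_pairs_equivalent f (-1) 1 eps) :
  exists C : set (R * R),
    [/\ C `<=` E_set f,
        connected C,
        C `&` (`[-1, 1] `*` [set 0]) !=set0 &
        ~ bounded_set C \/ C `&` ([set -1; 1] `*` [set: R]) !=set0].
Proof.
apply: contrapT => noC.
have bounded_away (C : set (R * R)) : C `<=` E_set f -> connected C ->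
    C `&` (`[-1, 1] `*` [set 0]) !=set0 ->
    bounded_set C /\ C `&` ([set -1; 1] `*` [set: R]) = set0.
  move=> CE cC CZ; split.
    by apply: contrapT => unb; apply: noC; exists C; split=> //; left.
  apply/eqP; rewrite -[_ == _]negbK; apply/negP => /set0P side.
  by apply: noC; exists C; split=> //; right.
have [D [DE cD cED [M DM]] axisD] :=
  @enclosing_axis _ _ (@closed_closure _ _) bounded_away.
pose axis : set (R * R) := `[-1, 1] `*` [set 0].
pose K := axis `|` D; pose F := E_set f `\` D.
have cK : compact K.
  have bD : bounded_set D.
    exists (`|M| + 1); split=> // N MN p /DM [/andP[p1 p1'] p2].
    have M1 := ler_norm M; have M0 := normr_ge0 M.
    by rewrite /= prod_normE ge_max ler_norml; apply/andP; split;
      [apply/andP; split|]; lra.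
  pose box : set (R * R) := `[-1, 1] `*` `[- M, M].
  have cbox : compact box by apply: compact_setX; exact: segment_compact.
  apply: compactU; first exact: axis_compact.
  rewrite (_ : D = box `&` D); first exact: compact_closedI.
  apply/seteqP; split=> p; last by case.
  move=> Dp; split=> //; have [/andP[p1 p1'] p2] := DM _ Dp.
  by split; rewrite /= in_itv /= ?(ltW p1) ?(ltW p1')// -ler_norml.
have KF : K `&` F = set0.
  apply/seteqP; split=> // p [[axp|Dp] [Ep nDp]]; apply: nDp => //.
  by apply: axisD.
have [d d0 dP] := compact_closed_dist cK cED KF.
have [eps eps0 nequiv] := not_equiv.
(* The bound [d / 4] keeps [F] off the bottom row and keeps [K] and [F] from being near adjacent
   vertices; [eps / 2] puts [e] in the range of the last hypothesis. *)
pose e := Num.min (d / 4) (eps / 2).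
have e0 : 0 < e by rewrite lt_min !divr_gt0.
have e_d : e <= d / 4 by rewrite ge_min lexx.
have e_eps : e < eps.
  by rewrite (@le_lt_trans _ _ (eps / 2))// ?ge_min ?lexx ?orbT//; lra.
apply: (nequiv e); first by rewrite e0.
pose r := e / 2 / 2.
have r0 : 0 < r by rewrite !divr_gt0.
(* The rows reach above [D], so that [K] misses the top one. *)
pose m := (Num.truncn (`|M| / r)).+1.
have m_M : `|M| < m%:R * r by rewrite -ltr_pdivrMr// truncnS_gt.
(* The window contains all the levels of the grid with a margin [r], enough for two drifts. *)
pose Nb := (Num.truncn (e + m%:R * r + r)).+1.
have NbP : e + m%:R * r + r < Nb%:R by rewrite truncnS_gt.
have [Mp0 [_ HMp]] := partial1_bounded Nb.
pose Mp := `|Mp0| + 1; pose L := Mp + 1.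
have Mp_ge0 : 0 <= Mp by rewrite addr_ge0.
have L0 : 0 < L by rewrite ltr_wpDl.
(* The columns are made narrower than [d], with a drift of at most [r / 2] across each. *)
pose b := Num.min d (r / 2 / L).
have b0 : 0 < b by rewrite lt_min d0 !divr_gt0.
pose n := (Num.truncn (2 / b)).+1.
have n_b : 2 / n%:R < b.
  by rewrite ltr_pdivrMr ?ltr0n// mulrC -ltr_pdivrMr// truncnS_gt.
have Ln_r : 2 * (L * (2 / n%:R)) <= r.
  have : 2 / n%:R <= r / 2 / L.
    by rewrite (le_trans (ltW n_b))// ge_min lexx orbT.
  by rewrite ler_pdivlMr// mulrC; lra.
apply: (@pair_equiv_homotopy_equivalent R X
  (level_pair (slice f (-1)) e (- e)) (level_pair (slice f 1) e (- e))).
apply: (@end_slices_equiv R X f K F d `|M| e L Mp Nb%:R n m) => //.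
- move=> p p1 fp; apply: (HMp Mp).
    by rewrite /Mp (le_lt_trans (ler_norm _))// ltrDl.
  split; rewrite in_itv //=.
  have N1 : (1 : R) <= Nb%:R by rewrite ler1n.
  by case/andP: p1 => ? ?; apply/andP; split; lra.
- move=> l z l1 crit; have [->|z0] := eqVneq z 0.
    by left; left; split => //=; rewrite in_itv.
  have Ez : E_set f (l, z).
    by apply: subset_closure; split=> //; apply/eqP.
  by have [Dz|nDz] := pselect (D (l, z)); [left; right|right].
- by move=> l l1; left; split=> //=; rewrite in_itv.
- move=> p [[_ ->]//|/DM [/andP[p1 p1'] _]] [pE|pE].
    by rewrite pE ltxx in p1.
  by rewrite pE ltxx in p1'.
- move=> p [[_ ->]|/DM [_ p2]]; first by rewrite normr0.
  exact: le_trans p2 (ler_norm _).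
- by rewrite /L ltrDl.
- exact: ltW.
- by rewrite (lt_le_trans n_b)// ge_min lexx.
- by rewrite ltW// (le_lt_trans _ NbP)// lerD2l.
Qed.
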